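(* For each integer $d\ge 2$ let $G_d$ be the rooted tree (with multiple edges) having levels $1,\dots,d$ in which the root is the only vertex at level $1$, each vertex at level $i$ ($1\le i\le d-1$) has exactly $2^{2^i}$ children (at level $i+1$), and the edge between a vertex at level $i$ and each of its children has multiplicity $2^i$. Then the cover time $C(G_d)$ and the parameter $M(G_d)$ satisfy \[ C(G_d)=\Omega\big(M(G_d)\,d^2\big), \] that is, there is an absolute constant $c>0$ such that $C(G_d)\ge c\,M(G_d)\,d^2$ for all sufficiently large $d$.
   Context: For a finite connected undirected multigraph $G$ with vertex set $V$, consider the simple random walk on $G$ (at each step, move along a uniformly chosen edge incident with the current vertex, multiplicities counted). $C(i)$ is the expected number of steps a walk starting from $i$ takes until it has visited all vertices, and the cover time is $C(G)=\max_{i\in V}C(i)$. $H(i,j)$ is the expected number of steps a walk started at $i$ needs to reach $j$, and $\kappa(i,j)=H(i,j)+H(j,i)$. For $S\subseteq V$ with $|S|\ge 2$ let $\kappa_S=\min_{i,j\in S,\,i\ne j}\kappa(i,j)$, and \[ M(G)=\max_{S\subseteq V,\ |S|\ge 2}\kappa_S\ln|S| . \] *)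

(* Defs.v *)
From HB Require Import structures.
From mathcomp Require Import all_boot all_order all_algebra.
From mathcomp Require Import all_classical all_reals all_analysis.

Set Implicit Arguments.
Unset Strict Implicit.
Unset Printing Implicit Defensive.

Import Order.TTheory GRing.Theory Num.Theory.

Local Open Scope ring_scope.

(* [mult x y] is the number of parallel edges joining [x] and [y]. *)
Record multigraph := Multigraph {
  vertex :> finType;
  mult : vertex -> vertex -> nat;
  mult_sym : forall x y, mult x y = mult y x;
  mult_loopless : forall x, mult x x = 0%N;
  mult_connected : forall x y, connect (fun u v => (0 < mult u v)%N) x y
}.

Section RandomWalk.
Variables (R : realType) (G : multigraph).
Implicit Types (i j : G) (s w : seq G) (S : {set G}).

Definition degree i : nat := (\sum_j mult i j)%N.

Definition step_prob i j : R := (mult i j)%:R / (degree i)%:R.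

(* Probability that the first [size s] steps of the walk from [i] visit [s],
   in that order. *)
Fixpoint walk_prob i s : R :=
  if s is x :: s' then step_prob i x * walk_prob x s' else 1.

(* A stopping rule [Q] is a predicate on trajectories, initial vertex included;
   [stops Q w] says that [Q] holds of [w] but of no earlier stage of [w]. *)
Definition stops (Q : pred (seq G)) w : bool :=
  Q w && all (fun n => ~~ Q (take n w)) (iota 1 (size w).-1).

(* P(T = t), where T is the number of steps made by the walk from [i] before
   [Q] first holds. *)
Definition stop_prob (Q : pred (seq G)) i (t : nat) : R :=
  \sum_(s : t.-tuple G | stops Q (i :: s)) walk_prob i s.

(* E(T); the second summand is the contribution of the event T = +oo, and
   vanishes when that event has probability 0, because 0 * +oo = 0. *)
Definition expected_steps (Q : pred (seq G)) i : \bar R :=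
  (\sum_(0 <= t <oo) (t%:R * stop_prob Q i t)%:E
   + (1 - \sum_(0 <= t <oo) (stop_prob Q i t)%:E) * +oo)%E.

Definition hitting_time i j : \bar R := expected_steps (fun w => j \in w) i.

Definition cover_time_from i : \bar R :=
  expected_steps (fun w => [forall x : G, x \in w]) i.

Definition cover_time : \bar R := \big[maxe/-oo%E]_(i : G) cover_time_from i.

Definition commute_time i j : \bar R :=
  (hitting_time i j + hitting_time j i)%E.

Definition kappa S : \bar R :=
  \big[mine/+oo%E]_(i in S) \big[mine/+oo%E]_(j in S | i != j)
    commute_time i j.

Definition matthews_max : \bar R :=
  \big[maxe/-oo%E]_(S : {set G} | (2 <= #|S|)%N)
    (kappa S * (ln (#|S|%:R : R))%:E)%E.

End RandomWalk.

Section TreeG.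
Variable d : nat.

(* A vertex at level i is encoded by the sequence (a_1, ..., a_(i-1)) of choices
   of children on the path from the root, where a_j < 2 ^ (2 ^ j).  The bound
   2 ^ (2 ^ d) on the entries is only there to provide a finite ambient type. *)
Definition address_ok (s : seq nat) : bool :=
  all (fun k => nth 0%N s k < 2 ^ (2 ^ k.+1))%N (iota 0 (size s)).

Definition tree_vertex : finType :=
  {s : {bseq d.-1 of 'I_(2 ^ (2 ^ d))} | address_ok (map val s)}.

Definition address (u : tree_vertex) : seq nat := map val (val u).

Definition level (u : tree_vertex) : nat := (size (address u)).+1.

Definition is_child (u v : tree_vertex) : bool :=
  (level v == (level u).+1) && prefix (address u) (address v).

Definition tree_mult (u v : tree_vertex) : nat :=
  if is_child u v then (2 ^ level u)%N
  else if is_child v u then (2 ^ level v)%N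
  else 0%N.

Lemma is_child_asym u v : is_child u v -> is_child v u = false.
Proof.
by case/andP=> /eqP h _; apply/negP => /andP[/eqP h' _]; move: h'; rewrite h => /eqP; rewrite ltn_eqF // ltnW.
Qed.

Lemma tree_mult_sym u v : tree_mult u v = tree_mult v u.
Proof.
rewrite /tree_mult; case: ifP => [/is_child_asym -> //|_].
by case: ifP.
Qed.

Lemma tree_mult_loopless u : tree_mult u u = 0%N.
Proof. by rewrite /tree_mult /is_child ltn_eqF. Qed.

Lemma tree_mult_gt0 u v : (0 < tree_mult u v)%N = is_child u v || is_child v u.
Proof.
by rewrite /tree_mult; case: ifP => _; rewrite ?expn_gt0 //; case: ifP; rewrite ?expn_gt0.
Qed.

Lemma address_inj : injective address.
Proof. by move=> u v /(inj_map val_inj)/val_inj/val_inj. Qed.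

Lemma exists_parent u : address u != [::] -> exists v, is_child v u.
Proof.
case: u => -[s sz] /= ok; rewrite /address /=.
case/lastP: s sz ok => [//|s a] sz ok _.
have sz' : (size s <= d.-1)%N by apply: leq_trans sz; rewrite size_rcons.
have ok' : address_ok (map val (Bseq sz')).
  apply/allP => k; rewrite mem_iota /= add0n size_map => ks.
  move/allP: ok => /(_ k); rewrite mem_iota /= add0n size_map size_rcons ltnS.
  by move=> /(_ (ltnW ks)); rewrite map_rcons nth_rcons size_map ks.
exists (exist _ (Bseq sz') ok').
by rewrite /is_child /level /address /= !size_map size_rcons eqxx map_rcons prefix_rcons.
Qed.

Lemma tree_mult_connected u v :
  connect (fun x y => (0 < tree_mult x y)%N) u v.
Proof.
set e := (fun x y => _).
have esym : connect_sym e.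
  by apply: sym_connect_sym => x y; rewrite /e tree_mult_sym.
have toroot x : exists2 r, address r = [::] & connect e x r.
  have [n] := ubnP (size (address x)); elim: n x => // n IH x xn.
  have [ax|ax] := eqVneq (address x) [::]; first by exists x; rewrite ?connect0.
  have [y yx] := exists_parent ax.
  have /IH[r ar yr] : (size (address y) < n)%N.
    by case/andP: yx => /eqP[sx] _; rewrite sx in xn.
  exists r => //; apply: connect_trans yr; apply: connect1.
  by rewrite /e tree_mult_gt0 yx orbT.
have [r ar ur] := toroot u; have [q aq vq] := toroot v.
apply: connect_trans ur _; rewrite esym.
by rewrite -(address_inj (etrans aq (Logic.eq_sym ar))).
Qed.

Definition tree_G : multigraph :=
  Multigraph tree_mult_sym tree_mult_loopless tree_mult_connected.

End TreeG.

(* Main.v *)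
(** Commute times are at most a constant times the volume [vol] (the sum of the
    degrees) over the multiplicities along the path, so that [M(G_d) = O(vol)]: a
    set of more than [2 ^ 2 ^ i] vertices has two members in the subtree of one
    vertex of level [i], and these are at resistance [O(2 ^ - i)].

    For the lower bound [C(G_d) = Omega(vol * d ^ 2)], let the walk start at a
    vertex [r] of level about [d / 2].  The square root of the local time (visits
    per unit of degree) drops by a constant from a vertex to the most neglected of
    its [2 ^ 2 ^ i] children: a deviation of that size has probability
    [2 ^ - O(2 ^ i)].  Hence, if [r] has local time [c * d ^ 2], some leaf below
    [r] is unvisited with probability at least [1 / 2].  This is made rigorous by
    an explicit supermartingale, a product over children of binomial
    expectations, which is an upper bound on the conditional probability of
    covering the subtree of [r].  Combined with the martingale
    [t + hit r X_t - (vol / degree r) * #departures from r], it yields a function of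
    the trajectory that bounds the expected remaining time to cover from below. *)

Require Import Defs.
From mathcomp Require Import all_boot all_order all_algebra.
From mathcomp Require Import all_classical all_reals all_analysis.
From mathcomp Require Import ring lra zify.

Set Implicit Arguments.
Unset Strict Implicit.
Unset Printing Implicit Defensive.

Import Order.TTheory GRing.Theory Num.Theory.

Local Open Scope ring_scope.

(** * Binomial expectations *)

Section Binomial.
Variable R : realFieldType.
Implicit Types (p : R) (v k n s : nat) (f g : nat -> R).

(* The expectation of [f] at a binomial variable with parameters [v] and [p]. *)
Fixpoint binE p v f : R :=
  if v is v'.+1 then p * binE p v' (fun k => f k.+1) + (1 - p) * binE p v' f
  else f 0%N.

Lemma eq_binE p v f g : f =1 g -> binE p v f = binE p v g.
Proof.
elim: v f g => [|v IH] f g fg /=; first exact: fg.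
by rewrite (IH f g fg) (IH _ (fun k => g k.+1)) // => k; apply: fg.
Qed.

Lemma binE_cst p v a : binE p v (fun=> a) = a.
Proof. by elim: v => //= v ->; ring. Qed.

Lemma binED p v f g :
  binE p v (fun k => f k + g k) = binE p v f + binE p v g.
Proof. by elim: v f g => //= v IH f g; rewrite !IH; ring. Qed.

Lemma binEZ p v a f : binE p v (fun k => a * f k) = a * binE p v f.
Proof. by elim: v f => //= v IH f; rewrite !IH; ring. Qed.

Lemma binE_sum (I : Type) (r : seq I) p v (f : I -> nat -> R) :
  binE p v (fun k => \sum_(i <- r) f i k) = \sum_(i <- r) binE p v (f i).
Proof.
elim: r => [|i r IH]; last first.
  by rewrite big_cons -IH -binED; apply: eq_binE => k; rewrite big_cons.
by rewrite big_nil -[RHS](binE_cst p v); apply: eq_binE => k; rewrite big_nil.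
Qed.

Lemma le_binE p v f g : 0 <= p <= 1 -> (forall k, f k <= g k) ->
  binE p v f <= binE p v g.
Proof.
move=> /andP[p0 p1]; elim: v f g => [|v IH] f g fg //=.
by apply: lerD; apply: ler_wpM2l; rewrite ?subr_ge0 ?IH.
Qed.

Lemma binE_ge0 p v f : 0 <= p <= 1 -> (forall k, 0 <= f k) -> 0 <= binE p v f.
Proof. by move=> hp f0; rewrite -(binE_cst p v 0) le_binE. Qed.

Lemma binE_le1 p v f : 0 <= p <= 1 -> (forall k, f k <= 1) -> binE p v f <= 1.
Proof. by move=> hp f1; rewrite -[leRHS](binE_cst p v 1) le_binE. Qed.

Lemma binE_mean p v : binE p v (fun k => k%:R) = p *+ v.
Proof.
elim: v => //= v IH; rewrite (@eq_binE _ _ _ (fun k => 1 + k%:R)); last first.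
  by move=> k; rewrite -natr1 addrC.
by rewrite binED binE_cst IH mulrS; ring.
Qed.

(* [u * P(tau > v)] times [v] is at most [n] by Markov's inequality, where [tau]
   is the number of trials until the [n]-th success, of mean [n / u]. *)
Lemma binE_ge_waiting u v n : 0 <= u <= 1 ->
  u * v%:R * (1 - binE u v (fun k => (n <= k)%N%:R)) <= n%:R.
Proof.
move=> hu; have /andP[u0 u1] := hu.
have ge0 w m : 0 <= binE u w (fun k => (m <= k)%N%:R).
  by apply: binE_ge0.
elim: v n => [|v IH] n; first by rewrite mulr0 mul0r.
case: n => [|n].
  by rewrite (@eq_binE _ _ _ (fun=> 1)) // binE_cst subrr mulr0.
rewrite [binE _ _ _]/=.
rewrite (@eq_binE _ _ (fun k => (n < k.+1)%N%:R) (fun k => (n <= k)%N%:R)) //.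
have := IH n; have := IH n.+1; have := ge0 v n; have := ge0 v n.+1.
set a := binE _ _ _; set b := binE _ _ _ => a0 b0 ha hb.
rewrite -!natr1 in ha *.
have hab : (1 - u) * (u * v%:R * (1 - a)) <= (1 - u) * (n%:R + 1).
  by apply: ler_wpM2l => //; rewrite subr_ge0.
have hbb : u * (u * v%:R * (1 - b)) <= u * n%:R by apply: ler_wpM2l.
have h1 : 0 <= u * (u * b) by rewrite !mulr_ge0.
have h2 : 0 <= u * ((1 - u) * a) by rewrite !mulr_ge0 // subr_ge0.
lra.
Qed.

(** * Point probabilities of the binomial law *)

Definition binpmf p v k := binE p v (fun i => (i == k)%:R).

Lemma binpmf_ge0 p v k : 0 <= p <= 1 -> 0 <= binpmf p v k.
Proof. by move=> hp; apply: binE_ge0. Qed.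

(** The ratio of consecutive binomial probabilities, with denominators cleared so that it also holds
    for [p = 1] and for [k >= v]. *)
Lemma binpmf_recr p v k :
  k.+1%:R * (1 - p) * binpmf p v k.+1 = (v%:R - k%:R) * p * binpmf p v k.
Proof.
have S0 w : binpmf p w.+1 0 = (1 - p) * binpmf p w 0.
  rewrite /binpmf /= (@eq_binE _ _ _ (fun=> 0)) // binE_cst; ring.
have SS w m : binpmf p w.+1 m.+1 = p * binpmf p w m + (1 - p) * binpmf p w m.+1.
  by rewrite /binpmf /=; congr (_ * _ + _).
elim: v k => [|v IH] k.
  by rewrite /binpmf /=; case: k => [|k] /=; rewrite !(mulr0, subrr, mul0r).
rewrite SS; have := IH k; case: k => [|k] h.
  rewrite S0 mulrDr; move: h; rewrite -!natr1 !subr0 => h.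
  have -> : (0 + 1) * (1 - p) * (p * binpmf p v 0)
         + (0 + 1) * (1 - p) * ((1 - p) * binpmf p v 1)
       = (1 - p) * (p * binpmf p v 0)
         + (1 - p) * ((0 + 1) * (1 - p) * binpmf p v 1) by ring.
  by rewrite h; ring.
rewrite SS; have h' := IH k.
have -> : k.+2%:R * (1 - p) * (p * binpmf p v k.+1 + (1 - p) * binpmf p v k.+2)
    = k.+2%:R * (1 - p) * p * binpmf p v k.+1
      + (1 - p) * (k.+2%:R * (1 - p) * binpmf p v k.+2) by ring.
rewrite h.
have -> : (v.+1%:R - k.+1%:R) * p * (p * binpmf p v k + (1 - p) * binpmf p v k.+1)
   = p * ((v%:R - k%:R) * p * binpmf p v k)
     + (v%:R - k%:R) * p * (1 - p) * binpmf p v k.+1.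
  by rewrite -!(natr1 v) -!(natr1 k); ring.
by rewrite -h' -!natr1; ring.
Qed.

(** Iterates [binpmf_recr] with [v - k] replaced by [v]; the product is [(s + i)! / s!]. *)
Lemma binpmf_ratio p v s i : 0 <= p <= 1 ->
  binpmf p v (s + i) * (\prod_(s.+1 <= k < (s + i).+1) k%:R) * (1 - p) ^+ i
    <= (p *+ v) ^+ i * binpmf p v s.
Proof.
move=> hp; have /andP[p0 p1] := hp.
have pv0 : 0 <= p *+ v by rewrite mulrn_wge0.
elim: i => [|i IH]; first by rewrite addn0 big_geq // !expr0 !mulr1 mul1r.
rewrite addnS big_nat_recr /= ?ltnS ?leq_addr // exprSr.
set P := \prod_(_ <= _ < _) _.
have -> : binpmf p v (s + i).+1 * (P * (s + i).+1%:R) * ((1 - p) ^+ i * (1 - p))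
  = P * (1 - p) ^+ i * ((s + i).+1%:R * (1 - p) * binpmf p v (s + i).+1) by ring.
rewrite binpmf_recr exprS.
have X0 : 0 <= P * (1 - p) ^+ i.
  rewrite mulr_ge0 ?exprn_ge0 ?subr_ge0 //.
  by apply: prodr_ge0 => k _; rewrite ler0n.
have -> : P * (1 - p) ^+ i * ((v%:R - (s + i)%:R) * p * binpmf p v (s + i)) =
  ((v%:R - (s + i)%:R) * p) * (binpmf p v (s + i) * P * (1 - p) ^+ i) by ring.
apply: (@le_trans _ _ ((p *+ v) * (binpmf p v (s + i) * P * (1 - p) ^+ i))).
  apply: ler_wpM2r.
    by rewrite -mulrA mulr_ge0 ?binpmf_ge0.
  by rewrite -(mulr_natl p v) ler_wpM2r // lerBlDr lerDl ler0n.
by rewrite -[leRHS]mulrA ler_wpM2l.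
Qed.

End Binomial.

(** * Stopping times of the walk *)

Section Stopping.
Variables (R : realType) (G : multigraph) (Q : pred (seq G)).
Implicit Types (h s w : seq G) (x y i j : G) (t n : nat).

Let step := step_prob R (G := G).

Lemma step_prob_ge0 x y : 0 <= step_prob R x y.
Proof. by rewrite divr_ge0. Qed.

Lemma step_prob_sum x : (0 < degree x)%N -> \sum_y step_prob R x y = 1.
Proof.
move=> dx; rewrite -mulr_suml -natr_sum divff //.
by rewrite pnatr_eq0 -lt0n.
Qed.

(* A trajectory is split into its past [h] and its current vertex [x]. *)
Fixpoint stopP t h x : R :=
  if t is t'.+1 then
    if Q (rcons h x) then 0 else \sum_y step x y * stopP t' (rcons h x) y
  else (Q (rcons h x))%:R.

(** The probability P(T > t), where T counts the steps until [Q] first holds. *)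
Fixpoint aliveP t h x : R :=
  if Q (rcons h x) then 0 else
  if t is t'.+1 then \sum_y step x y * aliveP t' (rcons h x) y else 1.

(** The expectation of the truncated time min(T, t). *)
Fixpoint meanT t h x : R :=
  if t is t'.+1 then
    if Q (rcons h x) then 0 else 1 + \sum_y step x y * meanT t' (rcons h x) y
  else 0.

Lemma big_tuple_cons (A : finType) t (P : pred (t.+1.-tuple A)) (F : seq A -> R) :
  \sum_(s : t.+1.-tuple A | P s) F s
  = \sum_y \sum_(s : t.-tuple A | P [tuple of y :: s]) F (y :: s).
Proof.
rewrite pair_big_dep /=.
pose f (p : A * t.-tuple A) := [tuple of p.1 :: p.2].
rewrite (reindex f) //=.
exists (fun s : t.+1.-tuple A => (thead s, [tuple of behead s])).
  by move=> [y s] _; congr (_, _); apply: val_inj.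
by move=> s _; rewrite [s in RHS]tuple_eta.
Qed.

(** The past [h] is a parameter so that the induction can move the current vertex into it;
    [iota 1 t] ranges over the nonempty proper prefixes of [x :: s]. *)
Lemma stopPE t h x :
  \sum_(s : t.-tuple G | Q (h ++ x :: s) &&
      all (fun n => ~~ Q (h ++ take n (x :: s))) (iota 1 t)) walk_prob R x s
  = stopP t h x.
Proof.
elim: t h x => [|t IH] h x.
  rewrite (eq_bigl (fun s : 0.-tuple G => Q (rcons h x))); last first.
    by move=> s; rewrite tuple0 /= andbT -cats1.
  have [Qx|Qx] := boolP (Q (rcons h x)); last by rewrite big_pred0 //= (negbTE Qx).
  rewrite (eq_bigr (fun=> 1)); last by move=> s _; rewrite tuple0.
  by rewrite sumr_const card_tuple expn0 /= Qx.
rewrite (@big_tuple_cons _ _ _ (walk_prob R x)) /=.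
have [Qx|Qx] := boolP (Q (rcons h x)).
  rewrite big1 // => y _; rewrite big_pred0 // => s.
  by rewrite cats1 Qx andbF.
apply: eq_bigr => y _; rewrite -IH mulr_sumr; apply: eq_big => s.
  rewrite cats1 Qx /= cat_rcons; congr (_ && _).
  rewrite -[2%N]/(1 + 1)%N iotaDl all_map; apply: eq_in_all => n.
  by rewrite mem_iota => /andP[n0 _] /=; rewrite cat_rcons.
by [].
Qed.

Lemma stop_probE i t : stop_prob R Q i t = stopP t [::] i.
Proof.
rewrite -stopPE; apply: eq_bigl => s.
by rewrite /stops /= size_tuple.
Qed.

Lemma stopP_ge0 t h x : 0 <= stopP t h x.
Proof.
elim: t h x => [|t IH] h x //=; case: ifP => // _.
by apply: sumr_ge0 => y _; rewrite mulr_ge0 ?step_prob_ge0.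
Qed.

Lemma aliveP_ge0 t h x : 0 <= aliveP t h x.
Proof.
elim: t h x => [|t IH] h x /=; case: ifP => // _.
by apply: sumr_ge0 => y _; rewrite mulr_ge0 ?step_prob_ge0.
Qed.

Hypothesis deg_gt0 : forall x, (0 < degree x)%N.

Lemma stopP_alive t h x : \sum_(k < t.+1) stopP k h x = 1 - aliveP t h x.
Proof.
elim: t h x => [|t IH] h x.
  by rewrite big_ord1 /=; case: ifP => _; rewrite ?subr0 ?subrr.
have -> : \sum_(k < t.+2) stopP k h x
    = stopP 0 h x + \sum_(k < t.+1) stopP k.+1 h x by rewrite big_ord_recl.
rewrite /=; case: ifP => Qx; first by rewrite big1 ?addr0 ?subr0.
rewrite [false%:R]/(0 : R) add0r.
rewrite exchange_big /=.
under eq_bigr => y _ do rewrite -mulr_sumr IH mulrBr mulr1.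
by rewrite big_split /= step_prob_sum // sumrN.
Qed.

Lemma meanTE t h x :
  meanT t h x = \sum_(k < t.+1) k%:R * stopP k h x + t%:R * aliveP t h x.
Proof.
elim: t h x => [|t IH] h x.
  by rewrite big_ord1 !mul0r addr0.
have -> : \sum_(k < t.+2) k%:R * stopP k h x
    = \sum_(k < t.+1) k.+1%:R * stopP k.+1 h x.
  by rewrite big_ord_recl mul0r add0r.
rewrite /=; case: ifP => Qx.
  by rewrite mulr0 addr0 big1 // => k _; rewrite mulr0.
have -> : \sum_(i < t.+1) i.+1%:R * \sum_y step x y * stopP i (rcons h x) y
  = \sum_y step x y * (\sum_(k < t.+1) k%:R * stopP k (rcons h x) y
                       + \sum_(k < t.+1) stopP k (rcons h x) y).
  under eq_bigr => k _ do rewrite mulr_sumr.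
  rewrite exchange_big /=; apply: eq_bigr => y _.
  rewrite -big_split mulr_sumr; apply: eq_bigr => k _ /=.
  by rewrite -natr1; ring.
rewrite mulr_sumr -big_split /=.
rewrite -{1}(step_prob_sum (deg_gt0 x)) -big_split /=; apply: eq_bigr => y _.
by rewrite -/(step x y) IH stopP_alive -(natr1 t); ring.
Qed.

Lemma alive_le n m h x : (n <= m)%N -> aliveP m h x <= aliveP n h x.
Proof.
elim: n m h x => [|n IH] [|m] h x //= nm; case: ifP => // _.
  rewrite -(step_prob_sum (deg_gt0 x)); apply: ler_sum => y _.
  rewrite ler_piMr ?step_prob_ge0 //.
  by rewrite -subr_ge0 -stopP_alive sumr_ge0 // => k _; apply: stopP_ge0.
apply: ler_sum => y _; rewrite ler_wpM2l ?step_prob_ge0 //; exact: IH.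
Qed.

(** Induction on [t] gives E min(T, t) <= f. Hence P(T > n) <= f / n, so T is almost surely finite
    and the term at infinity vanishes. *)
Lemma expected_steps_le i (f : seq G -> G -> R) :
  (forall h x, 0 <= f h x) ->
  (forall h x, ~~ Q (rcons h x) ->
     1 + \sum_y step_prob R x y * f (rcons h x) y <= f h x) ->
  (expected_steps R Q i <= (f [::] i)%:E)%E.
Proof.
move=> f0 fS.
have le t h x : meanT t h x <= f h x.
  elim: t h x => [|t IH] h x //=; case: ifP => // /negbT Qx.
  apply: le_trans (fS h x Qx); rewrite lerD2l; apply: ler_sum => y _.
  by rewrite ler_wpM2l ?step_prob_ge0.
pose F := f [::] i.
have part n : \sum_(0 <= k < n) k%:R * stopP k [::] i <= F.
  apply: le_trans (le n [::] i); rewrite meanTE.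
  rewrite -(big_mkord xpredT (fun k => k%:R * stopP k [::] i)) big_nat_recr //=.
  by rewrite -addrA lerDl addr_ge0 ?mulr_ge0 ?stopP_ge0 ?aliveP_ge0.
have alive n : n%:R * aliveP n [::] i <= F.
  apply: le_trans (le n [::] i); rewrite meanTE lerDr.
  by apply: sumr_ge0 => k _; rewrite mulr_ge0 ?stopP_ge0.
have E1 : (\sum_(0 <= t <oo) (stop_prob R Q i t)%:E = 1)%E.
  apply/eqP; rewrite eq_le; apply/andP; split.
    apply: lime_le.
      by apply: is_cvg_nneseries => n _ _; rewrite lee_fin stop_probE stopP_ge0.
    apply: nearW => n; rewrite sumEFin lee_fin.
    case: n => [|n]; first by rewrite big_geq.
    under eq_bigr do rewrite stop_probE.
    by rewrite big_mkord stopP_alive lerBlDr lerDl aliveP_ge0.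
  apply/lee_addgt0Pr => e e0.
  pose n := (Num.truncn (F / e)).+1.
  have ne : F <= n%:R * e.
    by rewrite -ler_pdivrMr // ltW // truncnS_gt.
  have an : aliveP n [::] i <= e.
    have := le_trans (alive n) ne; rewrite ler_pM2l //; by rewrite ltr0n.
  apply: (@le_trans _ _ ((1 - aliveP n [::] i)%:E + e%:E)%E).
    by rewrite -EFinD lee_fin -addrA lerDl addrC subr_ge0.
  apply: leeD => //.
  have := @nneseries_lim_ge R (fun t => (stop_prob R Q i t)%:E) xpredT 0 n.+1.
  rewrite sumEFin big_mkord.
  under eq_bigr do rewrite stop_probE.
  rewrite stopP_alive; apply => k _ _.
  by rewrite lee_fin stop_probE stopP_ge0.
rewrite /expected_steps E1 subee // mul0e adde0.
apply: lime_le.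
  apply: is_cvg_nneseries => n _ _; rewrite lee_fin stop_probE.
  by rewrite mulr_ge0 ?stopP_ge0.
apply: nearW => n; rewrite sumEFin lee_fin.
under eq_bigr do rewrite stop_probE.
exact: part.
Qed.

(** Induction gives f <= E min(T, t) + M P(T > t). If T is infinite with positive probability, so is
    the expectation; otherwise P(T > t) tends to 0 and [t] can grow. *)
Lemma expected_steps_ge i (M : R) (f : seq G -> G -> R) :
  (forall h x, f h x <= M) ->
  (forall h x, Q (rcons h x) -> f h x <= 0) ->
  (forall h x, ~~ Q (rcons h x) ->
     f h x <= 1 + \sum_y step_prob R x y * f (rcons h x) y) ->
  ((f [::] i)%:E <= expected_steps R Q i)%E.
Proof.
move=> fM fQ fS.
have le t h x : f h x <= meanT t h x + M * aliveP t h x.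
  elim: t h x => [|t IH] h x /=; case: ifP => [Qx|/negbT Qx].
  - by rewrite mulr0 addr0 fQ.
  - by rewrite mulr1 add0r.
  - by rewrite mulr0 addr0 fQ.
  apply: le_trans (fS h x Qx) _; rewrite -addrA lerD2l mulr_sumr -big_split /=.
  apply: ler_sum => y _; rewrite mulrCA -mulrDr.
  by rewrite ler_wpM2l ?step_prob_ge0.
rewrite /expected_steps.
set S := (\sum_(0 <= t <oo) (t%:R * _)%:E)%E.
set P := (\sum_(0 <= t <oo) _)%E.
have sge0 n : (0 <= (stop_prob R Q i n)%:E)%E by rewrite lee_fin stop_probE stopP_ge0.
have ksge0 n : (0 <= (n%:R * stop_prob R Q i n)%:E)%E.
  by rewrite lee_fin mulr_ge0 // stop_probE stopP_ge0.
have S0 : (0 <= S)%E by apply: nneseries_ge0.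
have partS n : ((\sum_(k < n) k%:R * stopP k [::] i)%:E <= S)%E.
  have := @nneseries_lim_ge R (fun t => (t%:R * stop_prob R Q i t)%:E) xpredT 0 n.
  rewrite sumEFin big_mkord; under eq_bigr do rewrite stop_probE; by apply.
have P1 : (P <= 1)%E.
  apply: lime_le; first exact: is_cvg_nneseries.
  apply: nearW => -[|n]; rewrite sumEFin lee_fin; first by rewrite big_geq.
  under eq_bigr do rewrite stop_probE.
  by rewrite big_mkord stopP_alive lerBlDr lerDl aliveP_ge0.
have [Plt|Pge] := ltP P 1%E.
  have -> : ((1 - P) * +oo = +oo)%E.
    by rewrite gt0_muley // sube_gt0.
  by rewrite addey ?leey // gt_eqF // (lt_le_trans _ S0) // ltNy0.
have -> : (P = 1)%E by apply/eqP; rewrite eq_le P1.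
rewrite subee // mul0e adde0.
have small (e : R) : 0 < e -> exists n, forall m, (n <= m)%N -> aliveP m [::] i <= e.
  move=> e0; apply: contrapT => no.
  have big n : e <= aliveP n [::] i.
    rewrite leNgt; apply/negP => /ltW an; apply: no; exists n => m nm.
    exact: le_trans (alive_le [::] i nm) an.
  have : (P <= (1 - e)%:E)%E.
    apply: lime_le; first exact: is_cvg_nneseries.
    apply: nearW => n; apply: (@le_trans _ _ (\sum_(0 <= k < n.+1) (stop_prob R Q i k)%:E)%E).
      by rewrite big_nat_recr //= leeDl.
    rewrite sumEFin lee_fin; under eq_bigr do rewrite stop_probE.
    by rewrite big_mkord stopP_alive lerB.
  by move=> /(le_trans Pge); rewrite lee_fin lerBrDr gerDl leNgt e0.
apply/lee_addgt0Pr => e e0.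
have e2 : 0 < e / 2 by rewrite divr_gt0.
have M0 : 0 < `|M| + 1 by rewrite ltr_wpDl.
have [n hn] := small (e / 2 / (`|M| + 1)) (divr_gt0 e2 M0).
have [N hN] := small (e / 2 / n.+1%:R) (divr_gt0 e2 (ltr0Sn _ _)).
(* First [n] makes the term in [M] small; then [m] makes n P(T > m) small. *)
pose m := maxn N n.+1.
have aN : n%:R * aliveP m [::] i <= e / 2.
  have := hN m (leq_maxl _ _); rewrite ler_pdivlMr // => h; apply: le_trans h.
  by rewrite mulrC ler_wpM2l ?aliveP_ge0 // ler_nat.
have aM : M * aliveP n [::] i <= e / 2.
  have := hn n (leqnn _); rewrite ler_pdivlMr // => h; apply: le_trans h.
  by rewrite mulrC ler_wpM2l ?aliveP_ge0 // (le_trans (ler_norm M)) // lerDl.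
(* Up to n P(T > m), the part n P(T > n) of E min(T, n) is at most the sum of k P(T = k) over n < k
   <= m. *)
have mS : meanT n [::] i - n%:R * aliveP m [::] i <= \sum_(k < m.+1) k%:R * stopP k [::] i.
  have nm : (n < m)%N by rewrite leq_maxr.
  rewrite meanTE -!(big_mkord xpredT (fun k => k%:R * stopP k [::] i)).
  rewrite [leRHS](@big_cat_nat _ _ _ n.+1) //=; last exact: ltnW.
  rewrite -addrA lerD2l -mulrBr.
  have -> : aliveP n [::] i - aliveP m [::] i = \sum_(n.+1 <= k < m.+1) stopP k [::] i.
    have := stopP_alive m [::] i; rewrite -(big_mkord xpredT (fun k => stopP k [::] i)).
    rewrite (@big_cat_nat _ _ _ n.+1) //=; last exact: ltnW.
    by rewrite big_mkord stopP_alive => h; lra.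
  rewrite mulr_sumr !big_nat; apply: ler_sum => k /andP[nk _].
  by rewrite ler_wpM2r ?stopP_ge0 // ler_nat ltnW.
apply: (@le_trans _ _ ((\sum_(k < m.+1) k%:R * stopP k [::] i)%:E + e%:E)%E); last first.
  by rewrite leeD2r.
rewrite -EFinD lee_fin; have := le n [::] i; lra.
Qed.

End Stopping.

(** * Hitting times and resistance *)

Section Potential.
Variables (R : realType) (G : multigraph).
Implicit Types (x y i j : G) (f g : G -> R).
Hypothesis deg_gt0 : forall x, (0 < degree x)%N.

Local Notation step := (step_prob R).

Definition volume : nat := (\sum_(x : G) degree x)%N.

Lemma step_prob_gt0 x y : (0 < step x y) = (0 < mult x y)%N.
Proof. by rewrite pmulr_lgt0 ?invr_gt0 ltr0n. Qed.

Lemma step_prob_eq0 x y : mult x y = 0%N -> step x y = 0.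
Proof. by move=> h; rewrite /step_prob h mul0r. Qed.

Lemma deg_step x y : (degree x)%:R * step x y = (mult x y)%:R.
Proof. by rewrite mulrC divfK // pnatr_eq0 -lt0n. Qed.

(** A negative minimum lies outside [B], where [f] dominates its neighbour average. So all
    neighbours share the value, and by connectedness it spreads to [b], a contradiction. *)
Lemma min_principle (B : pred G) f b : B b ->
  (forall x, ~~ B x -> \sum_y step x y * f y <= f x) ->
  (forall x, B x -> 0 <= f x) -> forall x, 0 <= f x.
Proof.
move=> Bb super f0 x.
case: (@arg_minP _ _ _ b xpredT f erefl) => x0 _ fmin.
apply: le_trans (fmin x erefl); rewrite leNgt; apply/negP => neg.
have same y z : f y = f x0 -> (0 < mult y z)%N -> f z = f x0.
  move=> fy yz; have nBy : ~~ B y.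
    by apply/negP => /f0; rewrite fy leNgt neg.
  have dif0 : \sum_z step y z * (f z - f x0) = 0.
    apply/eqP; rewrite eq_le; apply/andP; split; last first.
      by apply: sumr_ge0 => u _; rewrite mulr_ge0 ?step_prob_ge0 // subr_ge0 fmin.
    under eq_bigr do rewrite mulrBr.
    by rewrite sumrB -mulr_suml step_prob_sum // mul1r -fy subr_le0 super.
  have/eqP := dif0; rewrite psumr_eq0 => [/allP /(_ z)|u _]; last first.
    by rewrite mulr_ge0 ?step_prob_ge0 // subr_ge0 fmin.
  rewrite mem_index_enum => /(_ isT) /=; rewrite mulf_eq0 gt_eqF ?step_prob_gt0 //=.
  by rewrite subr_eq0 => /eqP.
have conn y : connect (fun u v : G => (0 < mult u v)%N) x0 y -> f y = f x0.
  move=> /connectP[p pp ->]; elim/last_ind: p pp => // p z IH.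
  rewrite rcons_path last_rcons => /andP[/IH h]; exact: same.
by have := f0 b Bb; rewrite (conn b (mult_connected _ _)) leNgt neg.
Qed.

(** A linear system with one equation per vertex. An element of the kernel vanishes at [j] and is
    harmonic elsewhere; the minimum principle for it and its negative makes it 0. *)
Lemma potential_exists j : exists h : G -> R, h j = 0 /\
  forall x, x != j -> h x = 1 + \sum_y step x y * h y.
Proof.
pose A : 'M[R]_#|G| := \matrix_(a, b)
  ((enum_val a == enum_val b)%:R - (enum_val a != j)%:R * step (enum_val a) (enum_val b)).
have AE (v : 'cV[R]_#|G|) x : (A *m v) (enum_rank x) 0
    = v (enum_rank x) 0 - (x != j)%:R * \sum_y step x y * v (enum_rank y) 0.
  rewrite mxE (reindex (@enum_rank G)) /=; last first.
    by apply: onW_bij; apply: enum_rank_bij.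
  under eq_bigr do rewrite mxE !enum_rankK mulrBl -mulrA.
  rewrite sumrB -mulr_sumr (bigD1 x) //= eqxx mul1r big1 ?addr0 // => y yx.
  by rewrite eq_sym (negbTE yx) mul0r.
have unitA : A \in unitmx.
  rewrite -unitmx_tr -row_free_unit -kermx_eq0; apply/rowV0P => u /sub_kermxP uA.
  have vA : A *m u^T = 0 by rewrite -[A]trmxK -trmx_mul uA trmx0.
  pose f x := u^T (enum_rank x) 0.
  have fj : f j = 0.
    by have := AE u^T j; rewrite vA [LHS]mxE eqxx mul0r subr0 => /esym.
  have fh x : x != j -> f x = \sum_y step x y * f y.
    move=> xj; have := AE u^T x; rewrite vA [LHS]mxE xj mul1r => /eqP.
    by rewrite eq_sym subr_eq0 => /eqP.
  have f_ge0 x : 0 <= f x.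
    apply: (@min_principle (pred1 j) f j) => /=; first exact: eqxx.
      by move=> y yj; rewrite -fh.
    by move=> y /eqP ->; rewrite fj.
  have f_le0 x : 0 <= - f x.
    apply: (@min_principle (pred1 j) (fun x => - f x) j) => /=; first exact: eqxx.
      by move=> y yj; under eq_bigr do rewrite mulrN; rewrite sumrN -fh.
    by move=> y /eqP ->; rewrite fj oppr0.
  apply/rowP => a; rewrite mxE -(enum_valK a).
  have -> : u 0 (enum_rank (enum_val a)) = f (enum_val a) by rewrite /f mxE.
  by apply/eqP; rewrite eq_le -oppr_ge0 f_le0 f_ge0.
pose v := invmx A *m (\col_a (enum_val a != j)%:R).
exists (fun x => v (enum_rank x) 0).
have vE x : v (enum_rank x) 0 - (x != j)%:R * (\sum_y step x y * v (enum_rank y) 0)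
    = (x != j)%:R.
  by rewrite -AE /v mulmxA mulmxV // mul1mx mxE enum_rankK.
split=> [|x xj]; first by have := vE j; rewrite eqxx mul0r subr0.
by have := vE x; rewrite xj mul1r => /eqP; rewrite subr_eq addrC => /eqP; rewrite addrC.
Qed.

(* [hit j x] is the expected time to reach [j] from [x]. *)
Definition hit j : G -> R := sval (cid (potential_exists j)).

Lemma hit_self j : hit j j = 0.
Proof. by rewrite /hit; case: cid => h []. Qed.

Lemma hitE j x : x != j -> hit j x = 1 + \sum_y step x y * hit j y.
Proof. by rewrite /hit; case: cid => /= h [_ hE]; exact: hE. Qed.

Lemma hit_ge0 j x : 0 <= hit j x.
Proof.
apply: (@min_principle (pred1 j) (hit j) j) => /=; first exact: eqxx.
  by move=> y /hitE ->; rewrite lerDr.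
by move=> y /eqP ->; rewrite hit_self.
Qed.

(** As functions of the starting point, both sides satisfy the same equation away from [j] and [k],
    so the minimum principle reduces the claim to these two vertices. *)
Lemma hit_triangle i j k : hit k i <= hit j i + hit k j.
Proof.
rewrite -subr_ge0.
apply: (@min_principle (pred2 j k) (fun x => hit j x + hit k j - hit k x) j) => /=.
- by rewrite eqxx.
- move=> x; rewrite negb_or => /andP[xj xk]; rewrite [in leRHS]hitE // [hit k x]hitE //.
  under eq_bigr do rewrite mulrBr mulrDr.
  by rewrite sumrB big_split /= -mulr_suml step_prob_sum // mul1r; lra.
- move=> x /orP[/eqP->|/eqP->]; first by rewrite hit_self add0r subrr.
  by rewrite hit_self subr0 addr_ge0 ?hit_ge0.
Qed.

(* Summing [degree * (hit - P hit)] over all vertices gives [0], by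
   reversibility. *)
Lemma hit_return j :
  \sum_y step j y * hit j y = volume%:R / (degree j)%:R - 1.
Proof.
have sym : \sum_x (degree x)%:R * (hit j x - \sum_y step x y * hit j y) = 0.
  under eq_bigr do rewrite mulrBr.
  rewrite sumrB; apply/eqP; rewrite subr_eq0; apply/eqP.
  under [RHS]eq_bigr do rewrite mulr_sumr.
  rewrite exchange_big /=; apply: eq_bigr => y _.
  rewrite natr_sum mulr_suml; apply: eq_bigr => x _.
  by rewrite mulrA deg_step mult_sym.
move: sym; rewrite (bigD1 j) //= hit_self sub0r.
have -> : \sum_(x | x != j) (degree x)%:R * (hit j x - \sum_y step x y * hit j y)
    = volume%:R - (degree j)%:R.
  rewrite /volume natr_sum [in RHS](bigD1 j) //= [RHS]addrC addKr.
  by apply: eq_bigr => x xj; rewrite [hit j x]hitE // addrK mulr1.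
move=> h; have dj : (degree j)%:R != 0 :> R by rewrite pnatr_eq0 -lt0n.
apply: (mulfI dj); rewrite mulrBr mulrCA divff // !mulr1; lra.
Qed.

(** A single term of [hit_return]: its weight is [mult j y / degree j], and the degrees cancel. *)
Lemma hit_edge j y : (0 < mult j y)%N -> hit j y <= volume%:R / (mult j y)%:R.
Proof.
move=> m0; rewrite ler_pdivlMr ?ltr0n // mulrC -deg_step -mulrA.
have d0 : 0 < (degree j)%:R :> R by rewrite ltr0n.
rewrite mulrC -ler_pdivlMr //.
apply: (@le_trans _ _ (\sum_y step j y * hit j y)).
  rewrite (bigD1 y) //= lerDl; apply: sumr_ge0 => z _.
  by rewrite mulr_ge0 ?step_prob_ge0 ?hit_ge0.
by rewrite hit_return gerBl.
Qed.

Lemma hitting_time_le i j : (hitting_time R i j <= (hit j i)%:E)%E.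
Proof.
apply: (@expected_steps_le R G _ deg_gt0 i (fun _ => hit j)).
  by move=> _ x; apply: hit_ge0.
move=> h x; rewrite mem_rcons in_cons negb_or => /andP[jx _].
by rewrite [leRHS]hitE // eq_sym.
Qed.

End Potential.

(** * The tree and its commute times *)

Section TreeStructure.
Variable d : nat.
Local Notation G := (tree_G d).
Implicit Types (u v x y c : G) (s : seq nat) (i : nat).

Lemma address_okP s :
  reflect (forall k, (k < size s)%N -> (nth 0%N s k < 2 ^ (2 ^ k.+1))%N)
          (address_ok s).
Proof.
apply: (iffP allP) => [h k ks|h k]; first by apply: h; rewrite mem_iota.
by rewrite mem_iota => /andP[_]; apply: h.
Qed.

Lemma address_wf u : address_ok (address u) /\ (size (address u) <= d.-1)%N.
Proof.
case: u => s ok; split; first exact: ok.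
by rewrite /address size_map size_bseq.
Qed.

Lemma address_surj s : address_ok s -> (size s <= d.-1)%N ->
  exists u, address u = s.
Proof.
move=> ok sz; pose t : seq 'I_(2 ^ (2 ^ d)) := pmap insub s.
have ts : map val t = s.
  rewrite /t (pmap_filter (insubK _)); apply/all_filterP/(all_nthP 0%N) => k ks.
  rewrite isSome_insub; apply: leq_trans (address_okP _ ok k ks) _.
  by rewrite !leq_exp2l // (leq_trans ks) // (leq_trans sz) // leq_pred.
have szt : (size t <= d.-1)%N by rewrite -(size_map val) ts.
have okt : address_ok (map val (Bseq szt)) by rewrite /= ts.
by exists (exist _ (Bseq szt) okt).
Qed.

Lemma is_childP u v :
  reflect (exists a, address v = rcons (address u) a) (is_child u v).
Proof.
apply: (iffP andP) => [[/eqP[sz] /prefixP[s def]]|[a def]].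
  move/eqP: sz; rewrite def size_cat /level -addn1 eqn_add2l.
  by case: s {def} => [|a [|b s]] // _; exists a; rewrite cats1.
by rewrite /level def size_rcons prefix_rcons.
Qed.

(** * Subtrees and ancestors *)

Definition in_subtree c x := prefix (address c) (address x).

Lemma in_subtree_refl c : in_subtree c c. Proof. exact: prefix_refl. Qed.

Lemma in_subtree_trans c x y :
  in_subtree c x -> in_subtree x y -> in_subtree c y.
Proof. exact: prefix_trans. Qed.

Lemma child_in_subtree c x : is_child c x -> in_subtree c x.
Proof. by case/andP. Qed.

Lemma child_level c x : is_child c x -> level x = (level c).+1.
Proof. by case/andP=> /eqP. Qed.

Lemma in_subtree_parent c x y : is_child y x -> in_subtree c x -> x != c ->
  in_subtree c y.
Proof.
move=> /is_childP[a ax] /prefixP[s sx] xc; apply/prefixP.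
case/lastP: s sx => [|s b] sx.
  by case/eqP: xc; apply: address_inj; rewrite sx cats0.
by move: sx; rewrite ax -rcons_cat => /rcons_inj[-> _]; exists s.
Qed.

Lemma child_subtree c x : in_subtree c x -> x != c ->
  exists2 c', is_child c c' & in_subtree c' x.
Proof.
move=> /prefixP[s sx] xc; case: s sx => [|a s] sx.
  by case/eqP: xc; apply: address_inj; rewrite sx cats0.
have [okx szx] := address_wf x.
have [c' c'E] : exists c' : G, address c' = rcons (address c) a.
  apply: address_surj; last by move: szx; rewrite sx size_cat size_rcons /=; lia.
  apply/address_okP => k; rewrite size_rcons => ks.
  have := address_okP _ okx k; rewrite sx -cat_rcons nth_cat size_rcons ks.
  by apply; rewrite size_cat size_rcons ltn_addr.
exists c'; first by apply/is_childP; exists a.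
by apply/prefixP; exists s; rewrite c'E cat_rcons.
Qed.

Lemma in_subtree_disjoint c c1 c2 x : is_child c c1 -> is_child c c2 ->
  in_subtree c1 x -> in_subtree c2 x -> c1 = c2.
Proof.
move=> /is_childP[a c1E] /is_childP[b c2E] /prefixP[s xE] /prefixP[t].
rewrite xE c1E c2E !cat_rcons => /eqP; rewrite eqseq_cat // eqxx /= eqseq_cons.
by case/andP=> /eqP ab _; apply: address_inj; rewrite c1E c2E ab.
Qed.

Lemma child_not_subtree c c' : is_child c c' -> in_subtree c' c = false.
Proof.
move=> /child_level lc; apply/negP => /size_prefix.
by move: lc; rewrite /level => -[->]; rewrite ltnn.
Qed.

Lemma in_subtree_anti c x : in_subtree c x -> in_subtree x c -> x = c.
Proof.
move=> cx; apply: contraTeq => /(child_subtree cx)[c' cc' c'x].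
by apply/negP => /(in_subtree_trans c'x); rewrite child_not_subtree.
Qed.

Lemma parent_uniq x y1 y2 : is_child y1 x -> is_child y2 x -> y1 = y2.
Proof.
move=> /is_childP[a xE] /is_childP[b]; rewrite xE => /rcons_inj[e _].
exact: address_inj.
Qed.

Lemma mult_gt0 x y : (0 < mult x y)%N = is_child x y || is_child y x.
Proof. exact: tree_mult_gt0. Qed.

Lemma subtree_enter c x y : (0 < mult x y)%N -> ~~ in_subtree c x ->
  in_subtree c y -> y = c /\ is_child x c.
Proof.
rewrite mult_gt0 => /orP[xy|yx] nx cy.
  have [yc|yc] := eqVneq y c; first by rewrite -yc.
  by rewrite (in_subtree_parent xy cy yc) in nx.
by rewrite (in_subtree_trans cy (child_in_subtree yx)) in nx.
Qed.

Lemma level_le u : (0 < d)%N -> (level u <= d)%N.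
Proof. by move=> d0; have [_] := address_wf u; rewrite /level; lia. Qed.

Lemma ancestor_exists i x : exists a : G, address a == take i.-1 (address x).
Proof.
have [okx szx] := address_wf x.
have [||a aE] := @address_surj (take i.-1 (address x)); last by exists a; rewrite aE.
- apply/address_okP => k; rewrite size_take_min leq_min => /andP[ki kx].
  by rewrite nth_take // (address_okP _ okx).
- by apply: leq_trans szx; rewrite size_take_min geq_minr.
Qed.

(** Addresses at level [i] have length [i - 1]; a vertex of level at most [i] is its own
    ancestor. *)
Definition ancestor i x : G := xchoose (ancestor_exists i x).

Lemma address_ancestor i x : address (ancestor i x) = take i.-1 (address x).
Proof. by apply/eqP; apply: xchooseP (ancestor_exists i x). Qed.

Lemma ancestor_subtree i x : in_subtree (ancestor i x) x.
Proof. by rewrite /in_subtree address_ancestor prefix_take. Qed.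

Lemma ancestor_level i x : (0 < i)%N -> level (ancestor i x) = minn i (level x).
Proof. by move=> i0; rewrite /level address_ancestor size_take_min; lia. Qed.

Lemma ancestor_id i x : (level x <= i)%N -> ancestor i x = x.
Proof.
move=> xi; apply: address_inj; rewrite address_ancestor take_oversize //.
by move: xi; rewrite /level; lia.
Qed.

Definition parent x := ancestor (level x).-1 x.

Lemma parent_child x : (1 < level x)%N -> is_child (parent x) x.
Proof.
rewrite /level ltnS => sx; apply/is_childP.
have [t [a def]] : exists t a, address x = rcons t a.
  by case/lastP: (address x) sx => // t a _; exists t, a.
exists a; rewrite /parent address_ancestor /level def size_rcons /=.
by rewrite -cats1 take_size_cat // cats1.
Qed.

(** * Numbers of vertices, and degrees *)

Lemma card_children c : (level c < d)%N ->
  #|[set v : G | is_child c v]| = (2 ^ (2 ^ level c))%N.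
Proof.
move=> cd; have [okc szc] := address_wf c.
have ex (a : 'I_(2 ^ (2 ^ level c))) : exists v : G, address v = rcons (address c) a.
  apply: address_surj; last by rewrite size_rcons; move: cd; rewrite /level; lia.
  apply/address_okP => k; rewrite size_rcons ltnS nth_rcons => kc.
  case: (ltngtP k (size (address c))) kc => [kc _|//|-> _]; first exact: (address_okP _ okc).
  exact: (ltn_ord a).
have [ch chE] := fin_all_exists ex.
have -> : [set v : G | is_child c v] = [set ch a | a in 'I_(2 ^ (2 ^ level c))].
  apply/setP => v; rewrite inE; apply/idP/imsetP => [/is_childP[a va]|[a _ ->]].
    have [okv _] := address_wf v.
    have av : (a < 2 ^ (2 ^ level c))%N.
      have := address_okP _ okv (size (address c)).
      by rewrite va size_rcons nth_rcons ltnn eqxx ltnSn; apply.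
    by exists (Ordinal av) => //; apply: address_inj; rewrite chE.
  by apply/is_childP; exists a; rewrite chE.
rewrite card_imset ?card_ord // => a b ab.
by apply: val_inj; have := chE a; rewrite ab chE => /rcons_inj[] /esym.
Qed.

(** If the levels up to [i] hold at most [N - 1] vertices, where [N] is the number of children at
    level [i], the next level adds at most [N] times as many, and [(N - 1) (N + 1) < N ^ 2]. *)
Lemma card_level_le i : (0 < i)%N ->
  (#|[set x : G | level x <= i]| < 2 ^ (2 ^ i))%N.
Proof.
case: i => // i _; elim: i => [|i IH].
  apply: (@leq_ltn_trans 1) => //; apply/card_le1P => x; rewrite inE => x1 y.
  rewrite !inE; apply/idP/eqP => [y1|->//]; apply: address_inj.
  by move: x1 y1; rewrite /level !ltnS !leqn0 !size_eq0 => /eqP-> /eqP->.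
set A := [set x : G | (level x <= i.+1)%N]; set N := (2 ^ (2 ^ i.+1))%N.
pose L := [set x : G | level x == i.+2].
have -> : [set x : G | (level x <= i.+2)%N] = A :|: L.
  by apply/setP => x; rewrite !inE orbC -leq_eqVlt.
have LA : (#|L| <= #|A| * N)%N.
  rewrite -sum1_card (partition_big parent (fun y => y \in A)) /=; last first.
    move=> x; rewrite !inE => /eqP lx; rewrite /parent ancestor_level lx //; lia.
  rewrite -sum_nat_const; apply: leq_sum => y; rewrite inE => yA.
  have [yd|yd] := ltnP (level y) d; last first.
    rewrite big_pred0 // => x; apply/negP => /andP[xL /eqP xy].
    have xc : is_child y x.
      by rewrite -xy parent_child //; move: xL; rewrite inE => /eqP->.
    have := child_level xc; have [_ szx] := address_wf x.
    by move: xL szx yd; rewrite inE /level => /eqP; lia.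
  have [yi|yi] := eqVneq (level y) i.+1; last first.
    rewrite big_pred0 // => x; apply/negP => /andP[xL /eqP xy].
    have lx : level x = i.+2 by move: xL; rewrite inE => /eqP.
    have xc : is_child y x by rewrite -xy parent_child // lx.
    by move: yi; have := child_level xc; rewrite lx => /eqP; rewrite eqSS eq_sym => ->.
  rewrite /N -yi -(card_children yd) sum1_card; apply: subset_leq_card.
  apply/fintype.subsetP => x /andP[xL /eqP xy]; rewrite inE -xy parent_child //.
  by move: xL; rewrite inE => /eqP->.
have NN : (2 ^ (2 ^ i.+2) = N * N)%N by rewrite /N -expnD addnn -mul2n -expnS.
apply: leq_ltn_trans (leq_card_setU A L).1 _.
have N0 : (0 < N)%N by rewrite expn_gt0.
have : (#|A| + #|A| * N < N * N)%N.
  rewrite -{2}(prednK N0); move: IH; rewrite -/A -/N -{1}(prednK N0) ltnS => aN.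
  have := leq_mul aN (leqnn N.+1); move: (#|A|) => a; rewrite -(prednK N0); lia.
by rewrite NN; apply: leq_ltn_trans; rewrite leq_add2l.
Qed.

Hypothesis d_gt1 : (1 < d)%N.

Lemma tree_degree_gt0 x : (0 < degree x)%N.
Proof.
suff [y xy] : exists y, (0 < mult x y)%N.
  by rewrite /degree (bigD1 y) //= ltn_addr.
have [x1|x1] := ltnP 1 (level x).
  by exists (parent x); rewrite mult_gt0 parent_child ?orbT.
have xd : (level x < d)%N by apply: leq_ltn_trans x1 d_gt1.
have := card_children xd; case: (pickP (is_child x)) => [y xy _|no].
  by exists y; rewrite mult_gt0 xy.
move=> h; have : (0 < 2 ^ (2 ^ level x))%N by rewrite expn_gt0.
by rewrite -h; case/card_gt0P => y; rewrite inE no.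
Qed.

(* [degree c] is [2 ^ (level c - 1)] times this number. *)
Definition fan i := (1 + 2 * 2 ^ (2 ^ i))%N.

Lemma mult_child c v : is_child c v -> mult c v = (2 ^ level c)%N.
Proof. by rewrite /= /tree_mult => ->. Qed.

Lemma tree_degree c : (1 < level c < d)%N -> degree c = (2 ^ (level c).-1 * fan (level c))%N.
Proof.
case/andP=> c1 cd; rewrite /degree (bigD1 (parent c)) //=.
have pc := parent_child c1.
rewrite {1}/tree_mult (is_child_asym pc) pc.
have lp : level (parent c) = (level c).-1 by rewrite (child_level pc).
rewrite (bigID (is_child c)) /= [X in (_ + (_ + X))%N]big1 ?addn0; last first.
  move=> v /andP[vp nv]; apply/eqP; rewrite -leqn0 leqNgt tree_mult_gt0 (negbTE nv) /=.
  by apply/negP => vc; rewrite (parent_uniq vc pc) eqxx in vp.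
rewrite (eq_bigr (fun=> 2 ^ level c)%N); last first.
  by move=> v /andP[_ cv]; rewrite /tree_mult cv.
rewrite (eq_bigl (fun v => v \in [set v : G | is_child c v])); last first.
  move=> v; rewrite inE; have [->|_] := eqVneq v (parent c); last by [].
  by rewrite (is_child_asym pc).
rewrite sum_nat_const card_children // lp /fan.
rewrite mulnDr muln1; congr (_ + _)%N.
by rewrite [RHS]mulnA -expnSr mulnC.
Qed.

Variable R : realType.

Lemma tree_step_sum c (g : G -> R) : (1 < level c < d)%N ->
  \sum_y step_prob R c y * g y = (fan (level c))%:R^-1 * g (parent c)
    + 2 / (fan (level c))%:R * \sum_(y | is_child c y) g y.
Proof.
move=> cl; have [c1 cd] := andP cl; have pc := parent_child c1.
have lc : level c = (level (parent c)).+1 := child_level pc.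
have f0 : (fan (level c))%:R != 0 :> R by rewrite pnatr_eq0.
have e0 : (2 ^ (level (parent c)))%:R != 0 :> R by rewrite pnatr_eq0 -lt0n expn_gt0.
rewrite (bigD1 (parent c)) //=; congr (_ * _ + _).
  rewrite /step_prob tree_degree // mult_sym (mult_child pc) lc /= natrM.
  by rewrite invfM mulrA divff // mul1r.
rewrite (bigID (is_child c)) /= [X in _ + X]big1 ?addr0; last first.
  move=> v /andP[vp nv]; rewrite step_prob_eq0 ?mul0r //.
  apply/eqP; rewrite -leqn0 leqNgt mult_gt0 (negbTE nv) /=.
  by apply/negP => vc; rewrite (parent_uniq vc pc) eqxx in vp.
rewrite mulr_sumr; apply: eq_big => [v|v /andP[_ cv]].
  have [->|_] := eqVneq v (parent c); last by [].
  by rewrite (is_child_asym pc).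
congr (_ * _); rewrite /step_prob tree_degree // (mult_child cv) lc /=.
rewrite expnS !natrM.
have cancel (a f : R) : a != 0 -> f != 0 -> 2 * a / (a * f) = 2 / f.
  by move=> a0 b0; field; rewrite a0 b0.
by apply: cancel; rewrite -?lc.
Qed.

(** * Commute times and the upper bound on [M] *)

Local Notation vol := (volume G)%:R.
Local Notation hit := (hit R tree_degree_gt0).

(** An edge from level [l] to level [l + 1] costs at most [vol / 2 ^ l = vol * (2 / 2 ^ l - 2 / 2 ^
    (l + 1))] in either direction, and these bounds telescope along the path. *)
Lemma hit_ancestor a x : in_subtree a x ->
  let b := vol * (2 / (2 ^ level a)%:R - 2 / (2 ^ level x)%:R) in
  hit a x <= b /\ hit x a <= b.
Proof.
move=> ax b; rewrite {}/b; have [n] := ubnP (level x); elim: n x ax => // n IH x ax xn.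
have [->|xa] := eqVneq x a; first by rewrite !hit_self subrr mulr0.
have [|x1] := leqP (level x) 1.
  move=> l; case/eqP: xa; apply: address_inj; move: l ax.
  rewrite /level ltnS leqn0 size_eq0 /in_subtree => /eqP ->.
  by rewrite prefixs0 => /eqP.
have px := parent_child x1; set y := parent x in px.
have lx : level x = (level y).+1 := child_level px.
have [|h1 h2] := IH y (in_subtree_parent px ax xa); first by rewrite -ltnS -lx.
have m0 : (0 < mult y x)%N by rewrite mult_gt0 px.
have := hit_edge R tree_degree_gt0 m0.
have := @hit_edge R _ tree_degree_gt0 x y; rewrite mult_sym => /(_ m0).
rewrite (mult_child px) => e1 e2.
have t1 := hit_triangle R tree_degree_gt0 x y a.
have t2 := hit_triangle R tree_degree_gt0 a y x.
have halve (v q : R) : q != 0 -> v / q = v * (2 / q - 2 / (2 * q)).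
  by move=> q0; field.
have e : vol / (2 ^ level y)%:R + vol * (2 / (2 ^ level a)%:R - 2 / (2 ^ level y)%:R)
    = vol * (2 / (2 ^ level a)%:R - 2 / (2 ^ level x)%:R) :> R.
  rewrite lx expnS natrM halve ?pnatr_eq0 -?lt0n ?expn_gt0 //.
  by rewrite -mulrDr addrC addrA subrK.
rewrite -e; split; first exact: le_trans t1 (lerD e2 h1).
by apply: le_trans t2 _; rewrite addrC; apply: lerD.
Qed.

Lemma hit_le_ancestor a x : in_subtree a x ->
  hit a x <= vol * (2 / (2 ^ level a)%:R) /\ hit x a <= vol * (2 / (2 ^ level a)%:R).
Proof.
move=> /hit_ancestor[h1 h2]; split; [apply: le_trans h1 _|apply: le_trans h2 _];
by rewrite ler_wpM2l // gerBl divr_ge0.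
Qed.

Lemma hit_le_volume x y : hit x y <= 4 * vol.
Proof.
have ax := hit_le_ancestor (ancestor_subtree 1 x).
have ay := hit_le_ancestor (ancestor_subtree 1 y).
have rr : ancestor 1 x = ancestor 1 y.
  by apply: address_inj; rewrite !address_ancestor !take0.
move: ax ay; rewrite rr ancestor_level // => -[_ hx] [hy _].
have := hit_triangle R tree_degree_gt0 y (ancestor 1 y) x.
have : (minn 1 (level y) = 1)%N by rewrite /level; lia.
move=> e; rewrite e expn1 in hx hy; have : 0 <= vol :> R by [].
by rewrite divff ?mulr1 // in hx hy; lra.
Qed.

Lemma commute_time_le a x y : in_subtree a x -> in_subtree a y ->
  (commute_time R x y <= (vol * (8 / (2 ^ level a)%:R))%:E)%E.
Proof.
move=> /hit_le_ancestor[x1 x2] /hit_le_ancestor[y1 y2].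
apply: le_trans (leeD (hitting_time_le R tree_degree_gt0 x y)
                      (hitting_time_le R tree_degree_gt0 y x)) _.
rewrite -EFinD lee_fin.
have := hit_triangle R tree_degree_gt0 x a y.
have := hit_triangle R tree_degree_gt0 y a x.
have -> : 8 / (2 ^ level a)%:R = 4 * (2 / (2 ^ level a)%:R) :> R.
  by rewrite mulrA; congr (_ / _); ring.
rewrite mulrCA; lra.
Qed.

(** Choose [i] so that |S| exceeds the number of vertices of level at most [i] but is below
    [2 ^ 2 ^ (i + 1)]. By pigeonhole two members of [S] lie below one vertex of level [i]; their
    commute time is at most [8 vol / 2 ^ i], while [ln |S| <= 2 ^ (i + 1)]. *)
Lemma matthews_max_le : (matthews_max R G <= (16 * vol)%:E)%E.
Proof.
apply: bigmax_le => [|S S2]; first by rewrite leNye.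
have cover i : (d <= i)%N -> (#|S| < 2 ^ (2 ^ i))%N.
  move=> di; apply: leq_ltn_trans (card_level_le (_ : 0 < i)%N); last by lia.
  apply: subset_leq_card; apply/fintype.subsetP => x _; rewrite inE.
  by apply: leq_trans di; rewrite level_le // ltnW.
have [i [i0 Si iS]] : exists i, [/\ (0 < i)%N, (#|S| < 2 ^ (2 ^ i.+1))%N &
    (#|[set x : G | level x <= i]| < #|S|)%N].
  pose P i := (#|S| < 2 ^ (2 ^ i.+1))%N.
  have exP : exists i, P i by exists d; apply: cover.
  case: (ex_minnP exP) => m Pm mmin; case: m Pm mmin => [|m] Pm mmin.
    (* There is no level 0, so level 1 is taken: it holds only the root, and [S] has two
       elements. *)
    exists 1%N; split => //; first by apply: leq_trans Pm _; rewrite !leq_exp2l.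
    apply: leq_trans S2; rewrite ltnS; apply/card_le1P => x; rewrite inE => x1 y.
    rewrite !inE; apply/idP/eqP => [y1|->//]; apply: address_inj.
    by move: x1 y1; rewrite /level !ltnS !leqn0 !size_eq0 => /eqP-> /eqP->.
  exists m.+1; split => //; apply: leq_trans (card_level_le (ltn0Sn m)) _.
  by rewrite leqNgt; apply/negP => /mmin; rewrite ltnn.
have [x [y [xS yS xy axy]]] : exists x y, [/\ x \in S, y \in S, x != y &
    ancestor i x = ancestor i y].
  apply: contrapT => no.
  have inj : {in S &, injective (ancestor i)}.
    move=> x y xS yS axy; apply/eqP/negP => /negP xy; apply: no; exists x, y.
    by split=> //; apply/eqP.
  move: iS; rewrite ltnNge -(card_in_imset inj) => /negP; apply.
  apply: subset_leq_card; apply/fintype.subsetP => _ /imsetP[x _ ->].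
  by rewrite inE ancestor_level // geq_minl.
set a := ancestor i x.
(* A level smaller than [i] would force [a = x]. Then [y], distinct from [x] with the same ancestor,
   lies deeper than [i], so that [a] has level [i] after all. *)
have la : level a = i.
  rewrite /a ancestor_level //; apply/minn_idPl; rewrite leqNgt; apply/negP => xi.
  have e : a = x by rewrite /a ancestor_id // ltnW.
  have yi : (i < level y)%N.
    rewrite ltnNge; apply/negP => yi; case/eqP: xy.
    by rewrite -e /a axy ancestor_id.
  have := ancestor_level y i0; rewrite -axy -/a e; lia.
have kS : (kappa R S <= (vol * (8 / (2 ^ i)%:R))%:E)%E.
  have ySx : (y \in S) && (x != y) by rewrite yS.
  rewrite /kappa; apply: (@bigmin_inf _ _ _ _ x) => //.
  apply: (@bigmin_inf _ _ _ _ y); first by rewrite yS.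
  rewrite -la; apply: commute_time_le; first exact: ancestor_subtree.
  by rewrite /a axy ancestor_subtree.
have lnS : 0 <= ln (#|S|%:R : R) <= (2 ^ i.+1)%:R.
  rewrite ln_ge0 ?ler1n ?(ltnW S2) //=.
  have h : ln (#|S|%:R : R) <= ln ((2 ^ (2 ^ i.+1))%:R).
    by rewrite ler_ln ?posrE ?ltr0n ?ler_nat ?(ltnW Si) // ?expn_gt0 // (ltnW S2).
  apply: le_trans h _; rewrite natrX lnXn // -(mulr_natl (ln _)) ler_piMr //.
  by have := @le_ln1Dx R 1; rewrite -(natrD _ 1 1); apply.
apply: (@le_trans _ _ ((vol * (8 / (2 ^ i)%:R))%:E * (ln (#|S|%:R : R))%:E)%E).
  by rewrite lee_wpmul2r // lee_fin; case/andP: lnS.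
rewrite -EFinM lee_fin.
apply: (@le_trans _ _ (vol * (8 / (2 ^ i)%:R) * (2 ^ i.+1)%:R)).
  by rewrite ler_wpM2l ?mulr_ge0 //; case/andP: lnS.
rewrite expnS natrM le_eqVlt; apply/orP; left; apply/eqP; field.
by rewrite pnatr_eq0 -lt0n expn_gt0.
Qed.

End TreeStructure.

(** * A supermartingale bounding the probability of coverage *)

(** In the expansion of the right-hand product only the terms of degree at most one in [w] are kept;
    the others are nonnegative. *)
Lemma prodD_ge (R : realDomainType) (I : eqType) (r : seq I) (P : pred I) (a w : I -> R) :
  uniq r -> (forall i, 0 <= a i) -> (forall i, 0 <= w i) ->
  \prod_(i <- r | P i) a i
    + \sum_(i <- r | P i) w i * \prod_(k <- r | P k && (k != i)) a k
  <= \prod_(i <- r | P i) (a i + w i).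
Proof.
move=> + a0 w0; elim: r => [|i r IH]; first by rewrite !big_nil addr0.
move=> /andP[ir /IH{}IH].
have same : \sum_(k <- r | P k) w k * \prod_(l <- i :: r | P l && (l != k)) a l
   = (if P i then a i else 1) *
       \sum_(k <- r | P k) w k * \prod_(l <- r | P l && (l != k)) a l.
  rewrite mulr_sumr big_seq_cond [RHS]big_seq_cond; apply: eq_bigr => k /andP[kr _].
  rewrite big_cons; have -> : i != k by apply: contraNneq ir => ->.
  by rewrite andbT mulrCA; case: ifP; rewrite ?mul1r.
rewrite !big_cons same; case: ifP => Pi; last by rewrite mul1r.
rewrite eqxx andbF.
have -> : \prod_(k <- r | P k && (k != i)) a k = \prod_(k <- r | P k) a k.
  rewrite big_seq_cond [RHS]big_seq_cond; apply: eq_bigl => k.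
  have [kr|//] := boolP (k \in r).
  by have -> : k != i by [apply: contraNneq ir => <-]; rewrite andbT.
set Y := \prod_(_ <- _ | _) a _ in IH *; set S := \sum_(_ <- _ | _) _ in IH *.
have S0 : 0 <= S.
  by apply: sumr_ge0 => k _; rewrite mulr_ge0 ?prodr_ge0.
apply: (@le_trans _ _ ((a i + w i) * (Y + S))); last by rewrite ler_wpM2l ?addr_ge0.
have : 0 <= w i * S by rewrite mulr_ge0.
lra.
Qed.

Section CoverPotential.
Variables (R : realType) (d : nat) (bud : nat -> nat).
Local Notation G := (tree_G d).
Implicit Types (c x y : G) (h : seq G) (j v k N : nat).

Local Notation step := (step_prob R).

(** Strictly between the root and the leaves, this and [down_prob] are the probabilities of a step
    to the parent and to one given child. *)
Definition up_prob c : R := (fan (level c))%:R^-1.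
Definition down_prob c : R := 2 / (fan (level c))%:R.

(* Probability that [v] departures from [c] contain at least [N] steps to the
   parent of [c]. *)
Definition exit_prob c v N : R := binE (up_prob c) v (fun k => (N <= k)%:R).

(* [cover_bound j c h x N] bounds the probability that the subtree of [c], of
   height [j], is eventually visited by the walk with past [h] and current
   vertex [x], when it still has to leave this subtree through its root [N]
   times.  If this takes more than [bud (level c)] departures from [c] in total,
   the bound is [1]; otherwise [c] is granted all its departures, and the number
   of entries into each child subtree is binomial. *)
Fixpoint cover_bound j c h x N : R :=
  if j is j'.+1 then
    let v := (bud (level c) - count_mem c h)%N in
    1 - exit_prob c v N * (1 - \prod_(c' | is_child c c')
      binE (down_prob c) v (fun k => cover_bound j' c' h x (k + in_subtree c' x)))
  else ((c \in h) || (x == c) || (0 < N)%N)%:R.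

(** The number [v] of departures is free: at the starting vertex it comes from [V] instead of [bud].
    The summand [in_subtree c' x] is the exit owed by a walk now below [c']. *)
Definition children_bound j c v h x : R := \prod_(c' | is_child c c')
  binE (down_prob c) v (fun k => cover_bound j c' h x (k + in_subtree c' x)).

Lemma cover_boundS j c h x N : let v := (bud (level c) - count_mem c h)%N in
  cover_bound j.+1 c h x N
  = 1 - exit_prob c v N * (1 - children_bound j c v h x).
Proof. by []. Qed.

Lemma fan_gt2 c : 2 < (fan (level c))%:R :> R.
Proof.
have := expn_gt0 2 (2 ^ level c); rewrite ltr_nat /fan; lia.
Qed.

Lemma up_prob01 c : 0 <= up_prob c <= 1.
Proof.
have := fan_gt2 c => f2; rewrite invr_ge0 ler0n /= invf_le1; lra.
Qed.

Lemma down_prob01 c : 0 <= down_prob c <= 1.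
Proof.
have := fan_gt2 c => f2; rewrite divr_ge0 //= ler_pdivrMr; lra.
Qed.

Lemma exit_prob01 c v N : 0 <= exit_prob c v N <= 1.
Proof.
rewrite binE_ge0 ?up_prob01 //= binE_le1 ?up_prob01 // => k.
by rewrite lern1 leq_b1.
Qed.

Lemma exit_prob_antimono c v N M : (N <= M)%N -> exit_prob c v M <= exit_prob c v N.
Proof.
move=> NM; apply: le_binE (up_prob01 c) _ => k; rewrite ler_nat.
by case: (leqP M k) => // Mk; rewrite (leq_trans NM).
Qed.

Lemma cover_bound01 j c h x N : 0 <= cover_bound j c h x N <= 1.
Proof.
elim: j c N => [|j IH] c N; first by rewrite /= ler0n lern1 leq_b1.
rewrite cover_boundS; set v := (_ - _)%N.
have p01 c' k : 0 <= cover_bound j c' h x k <= 1 by apply: IH.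
have P01 : 0 <= children_bound j c v h x <= 1.
  rewrite prodr_ge0 ?prodr_ile1 // => [c' _|c' _].
    rewrite binE_ge0 ?binE_le1 ?down_prob01 // => k;
      by case/andP: (p01 c' (k + in_subtree c' x)%N).
  by rewrite binE_ge0 ?down_prob01 // => k; case/andP: (p01 c' (k + in_subtree c' x)%N).
have /andP[e0 e1] := exit_prob01 c v N; case/andP: P01 => P0 P1.
rewrite subr_ge0 gerBl mulr_ge0 ?subr_ge0 // andbT.
by rewrite mulr_ile1 ?subr_ge0 // gerBl.
Qed.

Lemma factor01 j c c' v h x m :
  0 <= binE (down_prob c) v (fun k => cover_bound j c' h x (k + m)) <= 1.
Proof.
rewrite binE_ge0 ?binE_le1 ?down_prob01 // => k;
by case/andP: (cover_bound01 j c' h x (k + m)).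
Qed.

Lemma children_bound01 j c v h x : 0 <= children_bound j c v h x <= 1.
Proof.
rewrite prodr_ge0 ?prodr_ile1 // => [c' _|c' _]; first exact: factor01.
by case/andP: (factor01 j c c' v h x (in_subtree c' x)).
Qed.

Lemma cover_bound_mono j c h x N M : (N <= M)%N ->
  cover_bound j c h x N <= cover_bound j c h x M.
Proof.
case: j => [|j] NM.
  rewrite ler_nat; case: (c \in h) => //=; case: (x == c) => //=.
  by case: N NM => // N; case: M.
rewrite !cover_boundS lerD2l lerN2 ler_wpM2r ?exit_prob_antimono //.
by rewrite subr_ge0; case/andP: (children_bound01 j c (bud (level c) - count_mem c h) h x).
Qed.

(** The past matters only through visits inside the subtree, and [x] only through the subtrees
    containing it. Whether [x] is [c] matters only at a leaf with no exit owed, hence the last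
    hypothesis. *)
Lemma cover_bound_local j c h h' x x' N :
  (forall z, in_subtree c z -> count_mem z h = count_mem z h') ->
  (forall z, in_subtree c z -> z != c -> in_subtree z x = in_subtree z x') ->
  (0 < N)%N \/ (x == c) = (x' == c) ->
  cover_bound j c h x N = cover_bound j c h' x' N.
Proof.
elim: j c N => [|j IH] c N hcount hsub hN.
  rewrite /= -!has_pred1 !has_count (hcount c) ?in_subtree_refl //.
  by case: hN => [->|->//]; rewrite !orbT.
rewrite !cover_boundS (hcount c) ?in_subtree_refl //.
set v := (_ - _)%N; congr (1 - _ * (1 - _)).
apply: eq_bigr => c' cc'; apply: eq_binE => k.
have sub z : in_subtree c' z -> in_subtree c z.
  exact: in_subtree_trans (child_in_subtree cc').
have subn z : in_subtree c' z -> z != c.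
  by move=> zc; apply: contraTneq zc => ->; rewrite child_not_subtree.
rewrite -(hsub c') ?sub ?subn ?in_subtree_refl //; apply: IH.
- by move=> z /sub; apply: hcount.
- by move=> z zc _; apply: hsub; [apply: sub|apply: subn].
- case x'c' : (in_subtree c' x); first by left; rewrite addn1.
  right; have xc' : (in_subtree c' x' = false).
    by rewrite -hsub // ?sub ?subn ?in_subtree_refl.
  have h0 z : in_subtree c' z = false -> (z == c') = false.
    by move=> zc; apply: contraFF zc => /eqP->; apply: in_subtree_refl.
  by rewrite !h0.
Qed.

Lemma count_mem_rcons x h z : count_mem z (rcons h x) = (count_mem z h + (x == z))%N.
Proof. by rewrite -cats1 count_cat /= addn0. Qed.

Lemma cover_bound_outside j c h x y N : ~~ in_subtree c x -> ~~ in_subtree c y ->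
  cover_bound j c (rcons h x) y N = cover_bound j c h x N.
Proof.
move=> cx cy.
have out z w : ~~ in_subtree c w -> in_subtree c z -> in_subtree z w = false.
  by move=> cw cz; apply: contraNF cw; apply: in_subtree_trans.
have neq z w : ~~ in_subtree c w -> in_subtree c z -> (w == z) = false.
  by move=> cw cz; apply: contraNF cw => /eqP->.
apply: cover_bound_local.
- by move=> z cz; rewrite count_mem_rcons (neq z x) ?addn0.
- by move=> z cz _; rewrite (out z x) // (out z y).
- by right; rewrite (neq c x) ?(neq c y) ?in_subtree_refl.
Qed.

(** The exit owed after an entry is already counted in [N.+1], so arriving at [c] changes
    nothing. *)
Lemma cover_bound_enter j c h x N : ~~ in_subtree c x ->
  cover_bound j c (rcons h x) c N.+1 = cover_bound j c h x N.+1.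
Proof.
move=> cx; apply: cover_bound_local; last by left.
- move=> z cz; rewrite count_mem_rcons; case: eqP => [xz|]; last by rewrite addn0.
  by rewrite xz cz in cx.
- move=> z cz zc; rewrite [RHS](_ : _ = false); last first.
    by apply: contraNF cx; apply: in_subtree_trans.
  by apply: contraNF zc => zc; rewrite (in_subtree_anti cz zc).
Qed.

Lemma card_children_prob c : (level c < d)%N ->
  down_prob c * #|is_child c|%:R = 1 - up_prob c.
Proof.
move=> cd; have f0 : (fan (level c))%:R != 0 :> R.
  by rewrite gt_eqF // (lt_trans _ (fan_gt2 c)).
have -> : #|is_child c| = (2 ^ (2 ^ level c))%N.
  by rewrite -(card_children cd) cardsE.
apply: (mulIf f0); rewrite mulrBl mul1r mulVf // mulrAC divfK //.
by rewrite /fan natrD natrM; ring.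
Qed.

(* Each child's factor is affine in the outcome of the next departure, and two
   children cannot both be entered at once: this negative correlation makes the
   product decrease on average. *)
Lemma children_bound_depart j c v h (t1 t2 : R) :
  (1 < level c < d)%N -> 0 <= t2 <= t1 ->
  up_prob c * (t1 * children_bound j c v (rcons h c) (parent c))
   + down_prob c * (\sum_(y | is_child c y) t2 * children_bound j c v (rcons h c) y)
  <= (up_prob c * t1 + (1 - up_prob c) * t2) * children_bound j c v.+1 h c.
Proof.
move=> cl /andP[t20 t12]; have /andP[c1 cd] := cl.
have pc := parent_child c1.
have /andP[u0 u1] := up_prob01 c; have /andP[p0 p1] := down_prob01 c.
set u := up_prob c in u0 u1 *; set p := down_prob c in p0 p1 *.
(* [a c'] is the factor of [c'] if the next departure goes elsewhere, [b c'] if it enters [c']; with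
   one more trial the factor is [a + p (b - a)]. *)
pose a c' := binE p v (fun k => cover_bound j c' h c k).
pose b c' := binE p v (fun k => cover_bound j c' h c k.+1).
have a0 c' : 0 <= a c'.
  by apply: binE_ge0 (down_prob01 c) _ => k; case/andP: (cover_bound01 j c' h c k).
have ab c' : a c' <= b c'.
  by apply: le_binE (down_prob01 c) _ => k; apply: cover_bound_mono.
have notin c' : is_child c c' -> ~~ in_subtree c' c.
  by move=> cc'; rewrite child_not_subtree.
pose A := \prod_(c' | is_child c c') a c'.
have EU : children_bound j c v (rcons h c) (parent c) = A.
  apply: eq_bigr => c' cc'; apply: eq_binE => k.
  have np : ~~ in_subtree c' (parent c).
    by apply: contra (notin _ cc') => /in_subtree_trans; apply; apply: child_in_subtree.
  by rewrite (negbTE np) addn0 cover_bound_outside // notin.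
have ED y : is_child c y -> children_bound j c v (rcons h c) y
    = b y * \prod_(c' | is_child c c' && (c' != y)) a c'.
  move=> cy; rewrite /children_bound (bigD1 y) //=; congr (_ * _).
    apply: eq_binE => k; rewrite in_subtree_refl addn1.
    by rewrite cover_bound_enter // notin.
  apply: eq_bigr => c' /andP[cc' c'y]; apply: eq_binE => k.
  have ny : ~~ in_subtree c' y.
    apply: contra c'y => c'y; apply/eqP.
    exact: in_subtree_disjoint cc' cy c'y (in_subtree_refl y).
  by rewrite (negbTE ny) addn0 cover_bound_outside // notin.
have EV : children_bound j c v.+1 h c
    = \prod_(c' | is_child c c') (a c' + p * (b c' - a c')).
  apply: eq_bigr => c' cc'; rewrite (negbTE (notin _ cc')).
  rewrite (@eq_binE _ _ _ _ (fun k => cover_bound j c' h c k)); last by move=> k; rewrite addn0.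
  by rewrite /= -/(a c') -/(b c') -/p; ring.
pose S := \sum_(y | is_child c y) p * (b y - a y) * \prod_(c' | is_child c c' && (c' != y)) a c'.
have AS : A + S <= children_bound j c v.+1 h c.
  rewrite EV; apply: prodD_ge => //; first exact: index_enum_uniq.
  by move=> y; rewrite mulr_ge0 // subr_ge0.
have sumE : p * (\sum_(y | is_child c y) t2 * children_bound j c v (rcons h c) y)
    = (1 - u) * t2 * A + t2 * S.
  have -> : (1 - u) * t2 * A = \sum_(y | is_child c y) p * t2 * A.
    by rewrite sumr_const -(card_children_prob cd) -/p -(mulr_natr (p * t2 * A)); ring.
  rewrite /S !mulr_sumr -big_split /=; apply: eq_bigr => y cy.
  have AE : A = a y * \prod_(c' | is_child c c' && (c' != y)) a c' by rewrite /A (bigD1 y).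
  by rewrite ED // AE; ring.
have S0 : 0 <= S.
  by apply: sumr_ge0 => y _; rewrite mulr_ge0 ?prodr_ge0 // mulr_ge0 // subr_ge0.
rewrite EU sumE.
have t0 : 0 <= u * t1 + (1 - u) * t2.
  by rewrite addr_ge0 ?mulr_ge0 ?subr_ge0 // (le_trans t20).
apply: le_trans (ler_wpM2l t0 AS).
have : t2 * S <= (u * t1 + (1 - u) * t2) * S.
  rewrite ler_wpM2r //; have : u * t2 <= u * t1 by rewrite ler_wpM2l.
  lra.
lra.
Qed.

Hypothesis d_gt1 : (1 < d)%N.

(** A walk inside owes [N.+1] exits; a step out leaves [N] of them, any other step all. *)
Definition superharmonic j c := forall h x N, in_subtree c x ->
  \sum_y step x y * cover_bound j c (rcons h x) y (N + in_subtree c y)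
    <= cover_bound j c h x N.+1.

(** A child subtree can be entered only from [c]. So a step from elsewhere affects at most the
    factor of the child subtree containing [x], and the product is linear in it. *)
Lemma children_bound_move j c v h x : x != c ->
  (forall c', is_child c c' -> superharmonic j c') ->
  \sum_y step x y * children_bound j c v (rcons h x) y <= children_bound j c v h x.
Proof.
move=> xc super.
have degx := tree_degree_gt0 d_gt1 x.
have same c' y : is_child c c' -> ~~ in_subtree c' x -> (0 < mult x y)%N ->
    binE (down_prob c) v (fun k => cover_bound j c' (rcons h x) y (k + in_subtree c' y))
    = binE (down_prob c) v (fun k => cover_bound j c' h x (k + in_subtree c' x)).
  move=> cc' nx xy; have ny : ~~ in_subtree c' y.
    apply/negP => /(subtree_enter xy nx)[yc' xc'].
    by rewrite (parent_uniq xc' cc') eqxx in xc.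
  by apply: eq_binE => k; rewrite (negbTE nx) (negbTE ny) addn0 cover_bound_outside.
have [c'' /andP[cc'' xc'']|none] := pickP (fun c' => is_child c c' && in_subtree c' x).
  rewrite /children_bound [leRHS](bigD1 c'') //=.
  set A := (X in _ <= _ * X).
  have A0 : 0 <= A.
    by apply: prodr_ge0 => c' _; case/andP: (factor01 j c c' v h x (in_subtree c' x)).
  rewrite (eq_bigr (fun y => A * binE (down_prob c) v
     (fun k => step x y * cover_bound j c'' (rcons h x) y (k + in_subtree c'' y)))); last first.
    move=> y _; rewrite binEZ; have [xy|xy] := posnP (mult x y).
      by rewrite step_prob_eq0 // !mul0r mulr0.
    rewrite (bigD1 c'') //= [RHS]mulrCA; congr (_ * _); rewrite mulrC; congr (_ * _).
    apply: eq_bigr => c' /andP[cc' c'c'']; apply: same => //.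
    by apply: contra c'c'' => xc'; rewrite (in_subtree_disjoint cc' cc'' xc' xc'').
  rewrite -mulr_sumr mulrC -binE_sum ler_wpM2r //.
  apply: le_binE (down_prob01 c) _ => k; rewrite xc'' addn1; exact: super.
rewrite (eq_bigr (fun y => step x y * children_bound j c v h x)).
  by rewrite -mulr_suml step_prob_sum // mul1r.
move=> y _; have [xy|xy] := posnP (mult x y).
  by rewrite step_prob_eq0 // !mul0r.
congr (_ * _); apply: eq_bigr => c' cc'; apply: same => //.
by have := none c'; rewrite cc' /= => ->.
Qed.

(** Induction on the height. At a leaf the right side is 1; strictly below [c] only [children_bound]
    moves; at [c] a departure uses one trial of the exits and one of the entries at once. *)
Lemma cover_bound_superharmonic j c : (1 < level c)%N -> (level c + j)%N = d ->
  superharmonic j c.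
Proof.
elim: j c => [|j IH] c c1 cd h x N cx; have degx := tree_degree_gt0 d_gt1 x.
  rewrite [leRHS]/= orbT -[leRHS](step_prob_sum R degx); apply: ler_sum => y _.
  rewrite ler_piMr ?step_prob_ge0 //.
  by case/andP: (cover_bound01 0 c (rcons h x) y (N + in_subtree c y)).
have super c' : is_child c c' -> superharmonic j c'.
  by move=> /child_level lc'; apply: IH; rewrite lc' //; lia.
have cld : (1 < level c < d)%N by rewrite c1; lia.
have [xc|xc] := eqVneq x c; last first.
  rewrite cover_boundS; set v := (_ - _)%N.
  have /andP[e0 _] := exit_prob01 c v N.+1.
  rewrite (eq_bigr (fun y => step x y * (1 - exit_prob c v N.+1)
      + exit_prob c v N.+1 * (step x y * children_bound j c v (rcons h x) y))); last first.
    move=> y _; have [xy|xy] := posnP (mult x y).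
      by rewrite step_prob_eq0 // !mul0r mulr0 addr0.
    have -> : in_subtree c y.
      apply/negPn/negP => ny; rewrite mult_sym in xy.
      by have [xc' _] := subtree_enter xy ny cx; rewrite xc' eqxx in xc.
    by rewrite cover_boundS count_mem_rcons (negbTE xc) addn0 addn1 -/v; ring.
  rewrite big_split -mulr_suml step_prob_sum // mul1r -mulr_sumr /=.
  have := ler_wpM2l e0 (@children_bound_move j c v h x xc super); lra.
(* With the budget spent, a positive number of exits has [exit_prob] 0, so the bound is 1. *)
subst x; have [v0|] := posnP (bud (level c) - count_mem c h)%N.
  rewrite [leRHS]cover_boundS v0 /exit_prob /= mul0r subr0.
  rewrite -[leRHS](step_prob_sum R degx); apply: ler_sum => y _.
  rewrite ler_piMr ?step_prob_ge0 //.
  by case/andP: (cover_bound01 j.+1 c (rcons h c) y (N + in_subtree c y)).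
case vE : (bud (level c) - count_mem c h)%N => [//|v] _.
rewrite tree_step_sum // -/(up_prob c) -/(down_prob c).
have v'E : (bud (level c) - count_mem c (rcons h c))%N = v.
  by rewrite count_mem_rcons eqxx; move: vE; lia.
have npc : in_subtree c (parent c) = false by rewrite child_not_subtree // parent_child.
rewrite npc addn0 !cover_boundS v'E vE.
rewrite (eq_bigr (fun y => (1 - exit_prob c v N.+1)
   + exit_prob c v N.+1 * children_bound j c v (rcons h c) y)); last first.
  move=> y cy; rewrite child_in_subtree // addn1 cover_boundS v'E; ring.
rewrite big_split /= sumr_const.
have eE : exit_prob c v.+1 N.+1
   = up_prob c * exit_prob c v N + (1 - up_prob c) * exit_prob c v N.+1.
  by rewrite /exit_prob /=; congr (_ * _ + _); apply: eq_binE => k; rewrite ltnS.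
have t12 : 0 <= exit_prob c v N.+1 <= exit_prob c v N.
  by rewrite exit_prob_antimono // andbT; case/andP: (exit_prob01 c v N.+1).
have := @children_bound_depart j c v h _ _ cld t12; rewrite -eE.
have := card_children_prob (proj2 (andP cld)); rewrite (_ : #|_| = #|is_child c|) //.
set D := #|_|%:R; set B := children_bound j c v.+1 h c.
set B0 := children_bound j c v _ (parent c); set B1 := \sum_(_ | _) _.
move=> pD; rewrite -(mulr_natr (1 - _)) -/D => dep.
rewrite [down_prob c * (_ + _)](_ : _ = (1 - exit_prob c v N.+1) * (down_prob c * D)
  + down_prob c * B1); last by ring.
by rewrite pD; rewrite eE in dep *; lra.
Qed.

Lemma cover_bound_covered j c h x N : (forall z, z \in rcons h x) ->
  cover_bound j c h x N = 1.
Proof.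
move=> cov; elim: j c N => [|j IH] c N /=.
  have := cov c; rewrite mem_rcons in_cons eq_sym => /orP[->|->] //.
  by rewrite orbT.
rewrite big1 ?subrr ?mulr0 ?subr0 // => c' _.
by rewrite (eq_binE _ _ (fun k => IH c' _)) binE_cst.
Qed.

(** * From the supermartingale to a lower bound on the cover time *)

Local Notation vol := ((volume G)%:R : R).
Local Notation hit := (hit R (tree_degree_gt0 d_gt1)).

(** In the proof [f] bounds the expected remaining time from below. [K] is the mean return time to
    [r], and [beta] bounds the mean number of departures to come: early coverage forfeits at most
    [V] of them. Subtracting [4 * vol], which dominates [hit], gives [f <= 0] on coverage. *)
Lemma cover_time_from_ge j (r : G) V : (1 < level r)%N -> (level r + j.+1)%N = d ->
  ((vol / (degree r)%:R * (V%:R * (1 - children_bound j r V [::] r)) - 4 * vol)%:E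
    <= cover_time_from R r)%E.
Proof.
move=> r1 rd; have rl : (1 < level r < d)%N by rewrite r1; lia.
have super c' : is_child r c' -> superharmonic j c'.
  by move=> /child_level lc'; apply: cover_bound_superharmonic; rewrite lc' //; lia.
set K := vol / _; have K0 : 0 <= K by rewrite divr_ge0.
pose beta h x : R := if (count_mem r h < V)%N then
  V%:R - (count_mem r h)%:R - V%:R * children_bound j r (V - count_mem r h) h x else 0.
pose f h x := hit r x - 4 * vol + K * beta h x.
have Phi0 v h x : 0 <= children_bound j r v h x.
  by case/andP: (children_bound01 j r v h x).
have -> : K * (V%:R * (1 - children_bound j r V [::] r)) - 4 * vol = f [::] r.
  rewrite /f /beta /= hit_self sub0r subn0 addrC; congr (_ + _ * _).
  by case: posnP => [->|_]; rewrite ?mul0r // subr0; ring.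
apply: (@expected_steps_ge _ _ _ (tree_degree_gt0 d_gt1) r (K * V%:R) f).
- move=> h x; rewrite /f; have := hit_le_volume d_gt1 R r x.
  have : K * beta h x <= K * V%:R.
    rewrite ler_wpM2l // /beta; case: ifP => // _.
    have : 0 <= V%:R * children_bound j r (V - count_mem r h) h x by rewrite mulr_ge0.
    have : 0 <= (count_mem r h)%:R :> R by [].
    lra.
  lra.
- move=> h x /forallP cov; rewrite /f; have := hit_le_volume d_gt1 R r x.
  suff : K * beta h x <= 0 by lra.
  rewrite mulr_ge0_le0 // /beta; case: ifP => // _.
  rewrite [children_bound _ _ _ _ _]big1; last first.
    move=> c' _; rewrite (eq_binE _ _ (fun k => cover_bound_covered _ _ _ cov)).
    by rewrite binE_cst.
  by rewrite mulr1 addrAC subrr sub0r oppr_le0.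
move=> h x _.
have degx := tree_degree_gt0 d_gt1 x.
have -> : \sum_y step x y * f (rcons h x) y
   = \sum_y step x y * hit r y - 4 * vol + K * \sum_y step x y * beta (rcons h x) y.
  rewrite (eq_bigr (fun y => step x y * hit r y - step x y * (4 * vol)
    + K * (step x y * beta (rcons h x) y))); last by move=> y _; rewrite /f; ring.
  by rewrite big_split sumrB -mulr_suml -mulr_sumr step_prob_sum // mul1r.
have affine a b (g : G -> R) :
    \sum_y step x y * (a - b * g y) = a - b * \sum_y step x y * g y.
  rewrite (eq_bigr (fun y => step x y * a - b * (step x y * g y))).
    by rewrite sumrB -mulr_suml -mulr_sumr step_prob_sum // mul1r.
  by move=> y _; ring.
have [xr|xr] := eqVneq x r; last first.
  rewrite /f hitE // -!addrA lerD2l lerD2l lerD2l ler_wpM2l //.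
  rewrite /beta count_mem_rcons (negbTE xr) addn0; case: ifP => _; last first.
    by rewrite big1 // => y _; rewrite mulr0.
  rewrite affine lerB // ler_wpM2l //; exact: children_bound_move.
(* The mean of [hit] after a departure from [r] is [K - 1], so it remains to see that [beta] drops
   by at most 1 on average. *)
subst x; rewrite /f hit_self hit_return sub0r.
suff : K * beta h r <= K * (1 + \sum_y step r y * beta (rcons h r) y) by rewrite -/K; lra.
rewrite ler_wpM2l // /beta count_mem_rcons eqxx addn1; case: ltnP => cV; last first.
  by rewrite ltnNge (leq_trans cV) //= addr_ge0 // sumr_ge0 // => y _; rewrite mulr0.
(* At the last departure counted, [beta] is at most 1 before and 0 after. *)
case: (ltnP (count_mem r h).+1 V) => [cV1|Vc]; last first.
  have -> : V = (count_mem r h).+1 by lia.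
  rewrite [X in 1 + X]big1; last by move=> y _; rewrite mulr0.
  rewrite -natr1; set P := children_bound _ _ _ _ _.
  have : 0 <= ((count_mem r h)%:R + 1) * P by rewrite mulr_ge0 ?addr_ge0 // /P Phi0.
  lra.
rewrite affine; have -> : (V - count_mem r h)%N = (V - (count_mem r h).+1).+1 by lia.
set v := (V - _)%N.
have := @children_bound_depart j r v h 1 1 rl; rewrite ler01 lexx => /(_ isT).
under eq_bigr do rewrite mul1r.
move=> dep; have PV : \sum_y step r y * children_bound j r v (rcons h r) y
    <= children_bound j r v.+1 h r.
  by rewrite tree_step_sum // -/(up_prob r) -/(down_prob r); lra.
have : V%:R * \sum_y step r y * children_bound j r v (rcons h r) y
    <= V%:R * children_bound j r v.+1 h r by rewrite ler_wpM2l.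
rewrite -natr1; lra.
Qed.

End CoverPotential.

(** * Lower tail of the binomial law *)

Section LowerTail.
Variable R : realFieldType.
Implicit Types (p x : R) (v m s w j n : nat).

Lemma bernoulli x n : -1 <= x -> 1 + n%:R * x <= (1 + x) ^+ n.
Proof.
move=> x1; elim: n => [|n IH]; first by rewrite mul0r addr0.
rewrite exprS; apply: (@le_trans _ _ ((1 + x) * (1 + n%:R * x))); last first.
  by rewrite ler_wpM2l //; lra.
have : 0 <= n%:R * (x * x) by rewrite mulr_ge0 // -expr2 sqr_ge0.
rewrite -natr1; lra.
Qed.

Lemma bernoulliB x n : x <= 1 -> 1 - n%:R * x <= (1 - x) ^+ n.
Proof. by move=> x1; have := @bernoulli (- x) n; rewrite mulrN lerN2; apply. Qed.

(** Since [(1 - x) (1 + x) <= 1], while [(1 + x) ^ n >= 2] by Bernoulli. *)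
Lemma expr1B_le_half x n : 0 <= x <= 1 -> 1 <= n%:R * x -> (1 - x) ^+ n <= 1 / 2.
Proof.
move=> /andP[x0 x1] nx; rewrite ler_pdivlMr //.
have y0 : 0 <= (1 - x) ^+ n by rewrite exprn_ge0 // subr_ge0.
apply: (@le_trans _ _ ((1 - x) ^+ n * (1 + x) ^+ n)).
  rewrite ler_wpM2l //; have := @bernoulli x n; lra.
rewrite -exprMn exprn_ile1 //; first by rewrite mulr_ge0 //; lra.
have : 0 <= x * x by rewrite mulr_ge0.
lra.
Qed.

(** [1 + 1 / j] is the inverse of [1 - 1 / (j + 1)], whose power [uphalf j] is at least 1/2 by
    Bernoulli; then square. *)
Lemma expr_1Dinv_le4 j : (0 < j)%N -> (1 + j%:R^-1) ^+ j <= 4 :> R.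
Proof.
move=> j0; have jR : 0 < j%:R :> R by rewrite ltr0n.
have half : (1 + j%:R^-1) ^+ uphalf j <= 2 :> R.
  have b : 1 / 2 <= (1 - j.+1%:R^-1) ^+ uphalf j :> R.
    apply: le_trans (bernoulliB _ _); last by rewrite invf_le1 ?ltr0n // ler1n.
    have : (uphalf j)%:R / j.+1%:R <= 1 / 2 :> R.
      rewrite ler_pdivrMr ?ltr0n // mulrAC ler_pdivlMr // mul1r -natrM ler_nat.
      by rewrite uphalf_half; have := odd_double_half j; case: (odd j); lia.
    by set y := _ / _ => hy; lra.
  have inv : (1 + j%:R^-1) * (1 - j.+1%:R^-1) = 1 :> R.
    by rewrite -natr1; field; rewrite !gt_eqF ?addr_gt0.
  have a0 : 0 <= (1 + j%:R^-1) ^+ uphalf j :> R by rewrite exprn_ge0 // addr_ge0 // invr_ge0 ltW.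
  have := ler_wpM2l a0 b; rewrite -exprMn inv expr1n; lra.
apply: (@le_trans _ _ ((1 + j%:R^-1) ^+ (uphalf j).*2)).
  rewrite ler_weXn2l //; last by rewrite uphalf_half; have := odd_double_half j; case: (odd j); lia.
  by rewrite lerDl invr_ge0 ltW.
rewrite -muln2 exprM expr2 -[leRHS]/(2 * 2)%:R natrM ler_pM // exprn_ge0.
Qed.

(** At most [m - s] of the factors are below [m], and each of these loses at most a ratio
    [m / s]. *)
Lemma prod_ge_expr m s i : (0 < s <= m)%N ->
  m%:R ^+ i <= (m%:R / s%:R) ^+ minn i (m - s) * \prod_(s.+1 <= k < (s + i).+1) k%:R :> R.
Proof.
move=> /andP[s0 sm]; have sR : 0 < s%:R :> R by rewrite ltr0n.
have ms1 : 1 <= m%:R / s%:R :> R by rewrite ler_pdivlMr // mul1r ler_nat.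
elim: i => [|i IH]; first by rewrite min0n addn0 big_geq // !expr0 mul1r.
rewrite addnS big_nat_recr /= ?ltnS ?leq_addr //.
set P := \prod_(_ <= _ < _) _ in IH *.
have P0 : 0 <= P by apply: prodr_ge0 => k _; rewrite ler0n.
have m0 : 0 <= m%:R :> R by [].
have [im|im] := ltnP i (m - s).
  rewrite (minn_idPl (ltnW im)) in IH; rewrite (minn_idPl im) !exprS.
  apply: (@le_trans _ _ (m%:R * ((m%:R / s%:R) ^+ i * P))); first by rewrite ler_wpM2l.
  have -> : m%:R / s%:R * (m%:R / s%:R) ^+ i * (P * (s + i).+1%:R)
    = m%:R * ((m%:R / s%:R) ^+ i * P) * ((s + i).+1%:R / s%:R) by field; rewrite gt_eqF.
  rewrite ler_peMr ?mulr_ge0 ?exprn_ge0 ?divr_ge0 //.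
  by rewrite ler_pdivlMr // mul1r ler_nat ltnW // ltnS leq_addr.
rewrite (minn_idPr im) in IH; rewrite (minn_idPr (leqW im)) exprSr mulrA.
rewrite ler_pM ?exprn_ge0 // ler_nat; lia.
Qed.

(** By Markov half of the mass is on [k <= 2 m], and each of the at most [2 m] points beyond [s]
    there has mass at most [2 r] times that at [s]. The condition on [p] keeps [(1 - p) ^ i >= 1/2]
    for [i <= 2 m]. *)
Lemma bin_lower_tail p v m s : 0 <= p <= 1 -> p *+ v = m%:R ->
  (0 < s <= m)%N -> 4 * m%:R * p <= 1 ->
  1 / 2 <= binE p v (fun k => (k <= s)%N%:R)
           * (1 + 4 * m%:R * (m%:R / s%:R) ^+ (m - s)).
Proof.
move=> hp pv sm mp; have /andP[p0 p1] := hp; have /andP[s0 sm'] := sm.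
have m0 : 0 < m%:R :> R by rewrite ltr0n (leq_trans s0).
set b := binE _ _ _; set r := (m%:R / s%:R) ^+ (m - s).
have r0 : 0 <= r by rewrite exprn_ge0 // divr_ge0.
have ms1 : 1 <= m%:R / s%:R :> R by rewrite ler_pdivlMr ?ltr0n // mul1r ler_nat.
have pmf_s : binpmf p v s <= b.
  by apply: le_binE => // k; rewrite ler_nat; case: eqP => // ->; rewrite leqnn.
have pmf i : (i <= 2 * m)%N -> binpmf p v (s + i) <= 2 * r * b.
  move=> im; have := binpmf_ratio v s i hp; rewrite pv.
  set P := \prod_(_ <= _ < _) _ => h.
  have P0 : 0 < P by rewrite /P big_nat; apply: prodr_gt0 => k /andP[sk _]; rewrite ltr0n; lia.
  have hm := prod_ge_expr i sm; rewrite -/P in hm.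
  have hr : m%:R ^+ i <= r * P.
    apply: le_trans hm _; rewrite ler_wpM2r ?(ltW P0) //.
    by rewrite ler_weXn2l // geq_minr.
  have h1 : 1 / 2 <= (1 - p) ^+ i.
    apply: le_trans (bernoulliB i p1).
    have : i%:R * p <= (2 * m)%:R * p by rewrite ler_wpM2r // ler_nat.
    rewrite natrM; lra.
  have q0 : 0 <= binpmf p v (s + i) * P by rewrite mulr_ge0 ?binpmf_ge0 // ltW.
  have h2 := ler_wpM2l q0 h1.
  have h3 : m%:R ^+ i * binpmf p v s <= r * P * b.
    by rewrite ler_pM ?exprn_ge0 ?binpmf_ge0.
  rewrite -(ler_pM2r P0); lra.
have markov : 1 / 2 <= binE p v (fun k => (k <= 2 * m)%N%:R).
  have -> : 1 / 2 = binE p v (fun k => 1 + (- (2 * m%:R)^-1) * k%:R).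
    by rewrite binED binE_cst binEZ binE_mean pv; field; rewrite gt_eqF.
  apply: le_binE => // k; case: leqP => km.
    by rewrite mulNr gerBl mulr_ge0 // invr_ge0 mulr_ge0 // ltW.
  rewrite mulNr subr_le0 mulrC ler_pdivlMr ?mulr_gt0 // mul1r -natrM ler_nat ltnW //.
apply: le_trans markov _.
have -> : binE p v (fun k => (k <= 2 * m)%N%:R)
   = b + \sum_(i < 2 * m - s) binpmf p v (s + i.+1).
  rewrite /b /binpmf -binE_sum -binED; apply: eq_binE => k.
  have [ks|ks] := leqP k s.
    rewrite big1 ?addr0 => [|i _]; last by case: eqP => //; lia.
    by congr (_%:R); apply/eqP; rewrite eqb1; lia.
  rewrite add0r; have [km|km] := leqP k (2 * m).
    have ki : (k - s.+1 < 2 * m - s)%N by lia.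
    rewrite (bigD1 (Ordinal ki)) //= big1 ?addr0 => [|i /eqP ik].
      by case: eqP => //; lia.
    case: eqP => // e; case: ik; apply: val_inj => /=; lia.
  by rewrite big1 // => i _; case: eqP => //; have := ltn_ord i; lia.
rewrite mulrDr mulr1 lerD2l.
apply: (@le_trans _ _ (\sum_(i < 2 * m - s) 2 * r * b)).
  by apply: ler_sum => i _; apply: pmf; have := ltn_ord i; lia.
rewrite sumr_const card_ord -(mulr_natr (2 * r * b)).
have b0 : 0 <= b by apply: binE_ge0.
have -> : b * (4 * m%:R * r) = 2 * r * b * (2 * m)%:R by rewrite natrM; ring.
by rewrite ler_wpM2l ?mulr_ge0 // ler_nat leq_subr.
Qed.

Lemma binE_le0 p v : binE p v (fun k => (k <= 0)%N%:R) = (1 - p) ^+ v.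
Proof.
elim: v => //= v IH; rewrite (@eq_binE _ _ _ (fun k => (k < 0)%N%:R) (fun=> 0)) //.
by rewrite binE_cst mulr0 add0r IH exprS.
Qed.

(** Here [m] is the mean number of entries into a child and [s] the number allowed;
    [m - s = (3 j + 5) w]. *)
Lemma children_tail_bounds j w (m := (j.+2 * j.+3 * w)%N) (s := (j.+1 ^ 2 * w)%N) :
  (j.+1 < w)%N ->
  [/\ (0 < s <= m)%N, (4 * m <= 2 ^ (64 * w))%N, (3 * (m - s) <= j.+1 * (15 * w))%N
    & (20 * j.+2 * m * 2 ^ (30 * w) <= 2 ^ (64 * w))%N].
Proof.
move=> jw; have w0 : (0 < w)%N by apply: leq_ltn_trans jw.
have expw k l : (0 < k)%N -> (k <= l)%N -> (w ^ k <= 2 ^ (l * w))%N.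
  move=> k0 kl; apply: (@leq_trans (2 ^ (k * w))).
    by rewrite mulnC expnM leq_exp2r // ltnW // ltn_expl.
  by rewrite leq_exp2l // leq_mul2r kl orbT.
have ms : m = (s + (3 * j + 5) * w)%N by rewrite /m /s; ring.
have mw : (m <= 2 * w ^ 3)%N.
  have -> : (2 * w ^ 3 = w * (2 * w) * w)%N by ring.
  by rewrite /m leq_mul // leq_mul //; move: jw; clear; lia.
clearbody m; split.
- by rewrite ms leq_addr andbT muln_gt0 expn_gt0.
- apply: (@leq_trans (2 ^ 3 * w ^ 3)).
    by rewrite -[(2 ^ 3)%N]/(4 * 2)%N -mulnA leq_mul2l mw.
  rewrite (_ : 64 * w = 61 * w + 3 * w)%N; last by rewrite -mulnDl.
  by rewrite expnD leq_mul ?expw // leq_exp2l // (leq_trans _ (leq_pmulr 61 w0)).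
- by rewrite ms addKn !mulnA leq_mul2r; apply/orP; right; clear; lia.
rewrite (_ : 64 * w = 34 * w + 30 * w)%N; last by rewrite -mulnDl.
rewrite expnD leq_mul2r; apply/orP; right.
apply: (@leq_trans (2 ^ 6 * w ^ 4)).
  apply: (@leq_trans (20 * w * (2 * w ^ 3))); first by rewrite leq_mul // leq_mul2l.
  rewrite (_ : 20 * w * (2 * w ^ 3) = 40 * w ^ 4)%N; first by rewrite leq_mul2r orbT.
  by ring.
rewrite (_ : 34 * w = 30 * w + 4 * w)%N; last by rewrite -mulnDl.
by rewrite expnD leq_mul ?expw // leq_exp2l // (leq_trans _ (leq_pmulr 30 w0)).
Qed.

(* A vertex of height [j + 1] with [D = 2 ^ (64 w)] children, given
   [(j + 1) (j + 2) w (1 + 2 D) / 2] departures: the expected number of children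
   entered at most [j ^ 2 w] times is large. *)
Lemma children_lower_tail j w (D := (2 ^ (64 * w))%N) v :
  (j < w)%N -> (v * 2 = j.+1 * j.+2 * w * (1 + 2 * D))%N ->
  2 * j.+1%:R <= D%:R * binE (2 / (1 + 2 * D)%:R) v (fun k => (k <= j ^ 2 * w)%N%:R) :> R.
Proof.
move=> jw vE; set p := 2 / _; set b := binE _ _ _.
have w0 : (0 < w)%N by apply: leq_ltn_trans jw.
have D0 : (0 < D)%N by rewrite expn_gt0.
have DR : 0 < D%:R :> R by rewrite ltr0n.
have qR : 0 < (1 + 2 * D)%:R :> R by rewrite ltr0n.
have pD : p * D%:R <= 1.
  by rewrite /p mulrAC ler_pdivrMr // mul1r natrD natrM; lra.
have hp : 0 <= p <= 1.
  rewrite divr_ge0 //= ler_pdivrMr // mul1r -[leLHS]/(2%:R) ler_nat; lia.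
have pv : p *+ v = (j.+1 * j.+2 * w)%:R.
  rewrite -mulr_natr /p mulrAC -natrM mulnC vE natrM mulfK // gt_eqF.
(* For [j = 0] no entry is allowed, and the probability is [(1 - p) ^ v]. A block of [E = D / 4]
   trials has no success with probability at least 1/2, and [v <= 9 w E]. *)
case: j jw vE @b pv => [|j] jw vE b pv.
  rewrite /b mul0n binE_le0 mulr1.
  pose E := (2 ^ (64 * w - 2))%N.
  have DE : D = (4 * E)%N by rewrite /D /E -[4%N]/(2 ^ 2)%N -expnD; congr (_ ^ _)%N; lia.
  have h1 : 1 / 2 <= (1 - p) ^+ E.
    apply: le_trans (bernoulliB _ _); last by case/andP: hp.
    by move: pD; rewrite DE natrM; lra.
  have h2 : (1 / 2) ^+ (9 * w) <= (1 - p) ^+ v.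
    apply: (@le_trans _ _ (((1 - p) ^+ E) ^+ (9 * w))).
      by apply: lerXn2r h1; rewrite nnegrE ?divr_ge0 // exprn_ge0 // subr_ge0; case/andP: hp.
    rewrite -exprM ler_wiXn2l ?subr_ge0 ?gerBl //; try by case/andP: hp.
    have E0 : (0 < E)%N by rewrite expn_gt0.
    move: vE; rewrite DE; nia.
  apply: (@le_trans _ _ (D%:R * (1 / 2) ^+ (9 * w))); last by rewrite ler_wpM2l // ltW.
  rewrite div1r exprVn ler_pdivlMr ?exprn_gt0 // -natrX -natrM ler_nat /D -expnS leq_exp2l //; lia.
have jR : 0 < j.+1%:R :> R by rewrite ltr0n.
have := @bin_lower_tail p v (j.+2 * j.+3 * w) (j.+1 ^ 2 * w) hp pv; rewrite -/b.
set m := (j.+2 * j.+3 * w)%N; set s := (j.+1 ^ 2 * w)%N => tail.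
have [sm m4D ms3 mD] := children_tail_bounds jw; rewrite -/m -/s -/D in sm m4D ms3 mD.
have m0 : (0 < m)%N by case/andP: sm; apply: leq_trans.
have mR : 1 <= m%:R :> R by rewrite ler1n.
have mp : 4 * m%:R * p <= 1.
  move: m4D; rewrite -(ler_nat R) natrM => h.
  have : p * (4 * m%:R) <= p * D%:R by rewrite ler_wpM2l //; case/andP: hp.
  lra.
have {tail} := tail sm mp; set r := _ ^+ (m - s) => tail.
have r30 : r <= (2 ^ (30 * w))%:R.
  have sR : 0 < s%:R :> R by rewrite ltr0n; case/andP: sm.
  (* Because [1 + 2 / (j + 1) <= (1 + 1 / (j + 1)) ^ 2]. The power [m - s] is then at most
     [4 ^ (15 w)], as [3 (m - s) <= (j + 1) 15 w]. *)
  have ratio : m%:R / s%:R <= (1 + j.+1%:R^-1) ^+ 3 :> R.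
    have mE : m%:R = (j.+1%:R + 1) * (j.+1%:R + 2) * w%:R :> R.
      by rewrite /m !natrM -(natr1 j.+1) -addn2 natrD.
    rewrite ler_pdivrMr // /s natrM natrX mE.
    have -> : (1 + j.+1%:R^-1) ^+ 3 * (j.+1%:R ^+ 2 * w%:R)
      = (j.+1%:R + 1) * (j.+1%:R + 2) * w%:R + (j.+1%:R + 1) / j.+1%:R * w%:R :> R.
      by field; rewrite gt_eqF.
    by rewrite lerDl mulr_ge0 // divr_ge0 // addr_ge0.
  apply: (@le_trans _ _ (((1 + j.+1%:R^-1) ^+ j.+1) ^+ (15 * w))).
    apply: (@le_trans _ _ (((1 + j.+1%:R^-1) ^+ 3) ^+ (m - s))).
      by apply: lerXn2r ratio; rewrite nnegrE ?divr_ge0 // exprn_ge0 // addr_ge0 // invr_ge0 ltW.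
    by rewrite -!exprM ler_weXn2l // lerDl invr_ge0 ltW.
  apply: (@le_trans _ _ (4 ^+ (15 * w))).
    apply: lerXn2r (expr_1Dinv_le4 (ltn0Sn j));
      by rewrite ?nnegrE ?exprn_ge0 ?addr_ge0 ?invr_ge0.
  by rewrite -[4]/(4%:R) -natrX ler_nat -[4%N]/(2 ^ 2)%N -expnM mulnA.
have b0 : 0 <= b by apply: binE_ge0.
set T : R := (2 ^ (30 * w))%:R in r30.
have T1 : 1 <= T by rewrite ler1n expn_gt0.
have DT : 20 * j.+2%:R * m%:R * T <= D%:R.
  by rewrite /T -!natrM ler_nat.
have m4 : 1 + 4 * m%:R * r <= 5 * (m%:R * T).
  have h1 : m%:R * r <= m%:R * T by rewrite ler_wpM2l.
  have h2 : 1 * 1 <= m%:R * T by rewrite ler_pM.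
  lra.
have h1 := ler_wpM2l b0 m4.
have h2 := ler_wpM2r b0 DT.
have h3 : 1 / 2 * j.+2%:R <= b * (5 * (m%:R * T)) * j.+2%:R.
  by rewrite ler_wpM2r // (le_trans tail).
lra.
Qed.

End LowerTail.

(** * Local times along the tree *)

Section Budgets.
Variables (R : realType) (d i0 : nat).
Hypothesis (d_gt1 : (1 < d)%N) (i0_gt6 : (6 < i0)%N) (d_le : (d <= 2 ^ (i0 - 6))%N).
Local Notation G := (tree_G d).

(* A vertex of height [j] at level [i], left [j ^ 2 * 2 ^ (i - 7)] times, is
   departed from at most [budget i] times with probability at least
   [1 / (j + 1)]. *)
Definition budget i := ((d - i) * (d - i).+1 * 2 ^ (i - 7) * fan i)%N.

(** With [w = 2 ^ (level c - 7)], the budget yields [j (j + 1) w] exits on average and [j ^ 2 w] are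
    required, so [binE_ge_waiting] bounds the failure probability by [j / (j + 1)]. *)
Lemma exit_prob_budget (c : G) j : (0 < j)%N -> (level c + j)%N = d ->
  1 / j.+1%:R <= exit_prob R c (budget (level c)) (j ^ 2 * 2 ^ (level c - 7)).
Proof.
move=> j0 cd; set w := (2 ^ (level c - 7))%N; set s := (_ * w)%N.
have jR : 0 < j%:R :> R by rewrite ltr0n.
have wR : 0 < w%:R :> R by rewrite ltr0n expn_gt0.
have := binE_ge_waiting (budget (level c)) s (up_prob01 R c).
rewrite -/(exit_prob R c _ _); set e := exit_prob _ _ _ _.
have -> : up_prob R c * (budget (level c))%:R = j%:R * j.+1%:R * w%:R.
  rewrite /up_prob /budget (_ : (d - level c)%N = j); last by lia.
  by rewrite !natrM mulrC mulfK // gt_eqF // (lt_trans _ (fan_gt2 R c)).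
rewrite /s natrM natrX => h.
have h' : j.+1%:R * (1 - e) <= j%:R.
  rewrite -(ler_pM2l (mulr_gt0 jR wR)); move: h; lra.
rewrite ler_pdivrMr ?ltr0n //; move: h'; rewrite -natr1; lra.
Qed.

Lemma leaf_bound (c x : G) k : ~~ in_subtree c x ->
  cover_bound R budget 0 c [::] x k <= 1 - (k <= 0 ^ 2 * 2 ^ (level c - 7))%N%:R / (2 * 1%:R).
Proof.
move=> cx; have xc : (x == c) = false.
  by apply: contraNF cx => /eqP ->; apply: in_subtree_refl.
rewrite /= xc mul0n leqn0 orFb; case: k => [|k] /=; lra.
Qed.

(** Each of the [D] factors is at most [1 - y] with [y = b / (2 (j + 1))], and [children_lower_tail]
    gives [D y >= 1], so the product is at most 1/2. *)
Lemma children_bound_step j (c x : G) : (i0 <= level c)%N -> (level c + j.+1)%N = d ->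
  (forall c', is_child c c' -> ~~ in_subtree c' x) ->
  (forall c', is_child c c' -> forall k, cover_bound R budget j c' [::] x k
     <= 1 - (k <= j ^ 2 * 2 ^ (level c' - 7))%N%:R / (2 * j.+1%:R)) ->
  children_bound R budget j c (budget (level c)) [::] x <= 1 / 2.
Proof.
move=> ci cd cx bound; set v := budget _; set w := (2 ^ (level c - 6))%N.
set D := (2 ^ (2 ^ level c))%N.
have DE : D = (2 ^ (64 * w))%N.
  rewrite /D /w -[64%N]/(2 ^ 6)%N -expnD; congr (2 ^ (2 ^ _))%N; lia.
(* The bound on [d] by [2 ^ (i0 - 6)] serves to keep the height below [w]. *)
have jw : (j < w)%N.
  apply: (@leq_trans d); first by lia.
  by apply: leq_trans d_le _; rewrite leq_exp2l // leq_sub2r.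
have vE : (v * 2 = j.+1 * j.+2 * w * (1 + 2 * 2 ^ (64 * w)))%N.
  rewrite /v /budget (_ : (d - level c)%N = j.+1); last by lia.
  rewrite /fan -/D -DE (_ : w = 2 * 2 ^ (level c - 7))%N; first by ring.
  by rewrite /w -expnS; congr (2 ^ _)%N; lia.
have := @children_lower_tail R j w v jw vE; rewrite -DE.
rewrite -[2 / _]/(down_prob R c).
set b := binE _ _ _ => tail.
pose y := b / (2 * j.+1%:R).
have j2 : 0 < 2 * j.+1%:R :> R by rewrite mulr_gt0.
have b0 : 0 <= b by apply: binE_ge0 (down_prob01 R c) _.
have b1 : b <= 1.
  by apply: binE_le1 (down_prob01 R c) _ => k; rewrite lern1 leq_b1.
have y0 : 0 <= y by rewrite divr_ge0 // ltW.
have y1 : y <= 1.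
  rewrite ler_pdivrMr // mul1r (le_trans b1) // -natrM ler1n; lia.
apply: (@le_trans _ _ ((1 - y) ^+ D)); last first.
  apply: expr1B_le_half; first by rewrite y0.
  by rewrite /y mulrA ler_pdivlMr // mul1r.
have cardD : #|is_child c| = D.
  rewrite /D -card_children ?cardsE //; lia.
rewrite -cardD -prodr_const; apply: ler_prod => c' cc'.
have := factor01 R budget j c c' v [::] x (in_subtree c' x); case/andP => -> _ /=.
apply: (@le_trans _ _ (binE (down_prob R c) v
    (fun k => 1 + (- (2 * j.+1%:R)^-1) * (k <= j ^ 2 * w)%N%:R))).
  apply: le_binE (down_prob01 R c) _ => k; rewrite (negbTE (cx _ cc')) addn0.
  apply: le_trans (bound _ cc' k) _.
  by rewrite (child_level cc') subSS mulNr [X in _ <= 1 - X]mulrC.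
by rewrite binED binE_cst binEZ mulNr mulrC.
Qed.

(** Induction from the leaves up: a product of at most 1/2 below [c'], with an exit probability of
    at least [1 / (j + 2)], gives the hypothesis of [children_bound_step] one level higher. *)
Lemma children_bound_budget j (c x : G) : (i0 <= level c)%N -> (level c + j.+1)%N = d ->
  (forall c', is_child c c' -> ~~ in_subtree c' x) ->
  children_bound R budget j c (budget (level c)) [::] x <= 1 / 2.
Proof.
elim: j c => [|j IH] c ci cd cx.
  apply: (children_bound_step ci cd cx) => c' cc' k; exact: leaf_bound (cx c' cc').
apply: (children_bound_step ci cd cx) => c' cc' k.
have lc' := child_level cc'.
have c'd : (level c' + j.+1)%N = d by lia.
rewrite cover_boundS /= subn0; set v := budget _.
have P2 : children_bound R budget j c' v [::] x <= 1 / 2.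
  apply: IH => //; first by lia.
  move=> c'' c'c''; apply: contra (cx _ cc').
  exact: in_subtree_trans (child_in_subtree c'c'').
have /andP[e0 _] := exit_prob01 R c' v k.
apply: (@le_trans _ _ (1 - exit_prob R c' v k * (1 / 2))).
  by rewrite lerD2l lerN2 ler_wpM2l //; lra.
rewrite lerD2l lerN2; have [ks|ks] := leqP; last by rewrite mul0r mulr_ge0.
have h := exit_prob_budget (ltn0Sn j) c'd.
have := le_trans h (exit_prob_antimono R c' v ks).
by rewrite [1 / j.+2%:R]mul1r invfM; set z := j.+2%:R^-1; rewrite -[true%:R]/(1 : R) mul1r; lra.
Qed.

End Budgets.

(** * The two bounds combined *)

Lemma level_surj d i : (0 < i <= d)%N -> exists u : tree_G d, level u = i.
Proof.
move=> /andP[i0 id].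
have [||u uE] := @address_surj d (nseq i.-1 0%N).
- by apply/address_okP => k; rewrite size_nseq nth_nseq => ->; rewrite expn_gt0.
- by rewrite size_nseq; lia.
by exists u; rewrite /level uE size_nseq prednK.
Qed.

(** The starting level [uphalf d] is deep enough for [d <= 2 ^ (i - 6)] and leaves a height of
    [d / 2], so that [budget / degree], of the order of the squared height, is of order [d ^ 2]. *)
Lemma cover_time_tree_ge (R : realType) d : (65 <= d)%N ->
  (((volume (tree_G d))%:R * (d%:R ^+ 2 / 1024))%:E <= cover_time R (tree_G d))%E.
Proof.
move=> d65; have d1 : (1 < d)%N by lia.
pose i := uphalf d; have iE : (d = i + d./2)%N by rewrite /i -[LHS]odd_double_half uphalf_half; lia.
have ih : (i <= (d./2).+1)%N by rewrite /i uphalf_half; case: (odd d).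
have [r rE] : exists r : tree_G d, level r = i by apply: level_surj; lia.
pose j := (d./2).-1.
have jE : (d./2 = j.+1)%N by lia.
have rd : (level r + j.+1)%N = d by rewrite rE; lia.
have di : (d <= 2 ^ (i - 6))%N.
  have pow n : (2 * (n + 11) <= 2 ^ (n + 5))%N by elim: n => // n IHn; rewrite !addSn expnS; lia.
  have := pow (i - 11)%N; rewrite (_ : (i - 11 + 5 = i - 6)%N); last by lia.
  by apply: leq_trans; lia.
have r1 : (1 < level r)%N by rewrite rE; lia.
rewrite /cover_time; apply: (@bigmax_sup _ _ _ _ r) => //.
apply: le_trans (cover_time_from_ge R (budget d) d1 (budget d i) r1 rd).
rewrite lee_fin; set vol := (volume _)%:R; set P := children_bound _ _ _ _ _ _ _.
have i6 : (6 < i)%N by lia.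
have P2 : P <= 1 / 2.
  rewrite /P -rE; apply: (@children_bound_budget R d i d1 i6 di); rewrite ?rE //.
  by rewrite -rE.
  by move=> c' rc'; rewrite child_not_subtree.
(* The factor [fan i] cancels, and [2 ^ (i - 1) = 64 * 2 ^ (i - 7)]. *)
have V : (budget d i)%:R / (degree r)%:R = j.+1%:R * j.+2%:R / 64 :> R.
  rewrite tree_degree ?rE; last by lia.
  rewrite /budget (_ : (d - i = j.+1)%N); last by lia.
  have -> : (i.-1 = i - 7 + 6)%N by lia.
  rewrite expnD !natrM; field.
  by rewrite !pnatr_eq0 -!lt0n /fan expn_gt0.
have vol0 : 0 <= vol by [].
have -> : vol / (degree r)%:R * ((budget d i)%:R * (1 - P)) =
   vol * (j.+1%:R * j.+2%:R / 64 * (1 - P)) by rewrite -V; ring.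
rewrite mulrC [4 * _]mulrC -mulrBr mulrC ler_wpM2l //.
have : j.+1%:R * j.+2%:R / 64 * (1 / 2) <= j.+1%:R * j.+2%:R / 64 * (1 - P).
  by rewrite ler_wpM2l ?mulr_ge0 //; lra.
(* The summand [4096 = 4 * 1024] absorbs the loss [4 * vol]; this is where [d] must be at least
   about 64. *)
have : d%:R ^+ 2 + 4096 <= 8 * (j.+1%:R * j.+2%:R) :> R.
  rewrite -natrX -!natrM -natrD ler_nat; nia.
lra.
Qed.

Theorem claim6p1 (R : realType) :
  exists c : R, 0 < c /\
  exists d0 : nat, forall d : nat, (2 <= d)%N -> (d0 <= d)%N ->
    (c%:E * matthews_max R (tree_G d) * (d%:R ^+ 2)%:E
       <= cover_time R (tree_G d))%E.
Proof.
(* 1/1024 comes from the cover time and 1/16 from [M <= 16 vol]. *)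
exists (1 / 1024 / 16); split; first by rewrite !divr_gt0 ?ltr01 ?ltr0n.
exists 65%N => d d2 d65; apply: le_trans (cover_time_tree_ge R d65).
have M := matthews_max_le d2 R.
have c0 : (0 <= (1 / 1024 / 16 : R)%:E)%E by rewrite lee_fin !divr_ge0 ?ler01 ?ler0n.
have d0 : (0 <= (d%:R ^+ 2 : R)%:E)%E by rewrite lee_fin exprn_ge0.
apply: le_trans (lee_wpmul2r d0 (lee_wpmul2l c0 M)) _.
rewrite -!EFinM lee_fin; set v := (volume _)%:R; set e := d%:R ^+ 2; lra.
Qed.
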